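(* Let $\mathscr{H}$ be a complex Hilbert space, $d\ge 1$, and let $\mathbf{A}=(A_1,A_2,\ldots,A_d)\in\mathbb{B}^d(\mathscr{H})$. (i) For all $\alpha,t$ with $0\le \alpha\le 1$ and $0\le t\le 1$, $$w_e(\mathbf{A})\le \frac1{\sqrt2}\max_{k}\{\|A_k\|^{t}\}\, w_e\left(|\mathbf{A}|^{2\alpha(1-t)}+i|\mathbf{A}^*|^{2(1-\alpha)(1-t)}\right)$$ $$\le \frac1{\sqrt2}\max_{k}\{\|A_k\|^{t}\}\sqrt{\left\|\sum_{k=1}^d\left(|A_k|^{4\alpha(1-t)}+|A_k^*|^{4(1-\alpha)(1-t)}\right)\right\|}\le \frac1{\sqrt2}\|\mathbf{A}\|^{t}\sqrt{\left\|\sum_{k=1}^d\left(|A_k|^{4\alpha(1-t)}+|A_k^*|^{4(1-\alpha)(1-t)}\right)\right\|}.$$ (ii) In particular (for $t=\frac12$), for all $\alpha$ with $0\le\alpha\le1$, $$w_e(\mathbf{A})\le \frac1{\sqrt2}\max_{k}\{\|A_k\|^{1/2}\}\, w_e\left(|\mathbf{A}|^{\alpha}+i|\mathbf{A}^*|^{1-\alpha}\right)$$ $$\le \frac1{\sqrt2}\max_{k}\{\|A_k\|^{1/2}\}\sqrt{\left\|\sum_{k=1}^d\left(|A_k|^{2\alpha}+|A_k^*|^{2(1-\alpha)}\right)\right\|}\le \frac1{\sqrt2}\|\mathbf{A}\|^{1/2}\sqrt{\left\|\sum_{k=1}^d\left(|A_k|^{2\alpha}+|A_k^*|^{2(1-\alpha)}\right)\right\|}.$$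 (iii) In particular (for $\alpha=\frac12$), $$w_e(\mathbf{A})\le \frac1{\sqrt2}\max_{k}\{\|A_k\|^{1/2}\}\, w_e\left(|\mathbf{A}|^{1/2}+i|\mathbf{A}^*|^{1/2}\right)$$ $$\le \frac1{\sqrt2}\max_{k}\{\|A_k\|^{1/2}\}\sqrt{\left\|\sum_{k=1}^d\left(|A_k|+|A_k^*|\right)\right\|}\le \frac1{\sqrt2}\|\mathbf{A}\|^{1/2}\sqrt{\left\|\sum_{k=1}^d\left(|A_k|+|A_k^*|\right)\right\|}.$$
   Context: $\mathbb{B}(\mathscr{H})$ is the algebra of bounded linear operators on the complex Hilbert space $\mathscr{H}$, and $\mathbb{B}^d(\mathscr{H})$ is the set of $d$-tuples of such operators. For $T\in\mathbb{B}(\mathscr{H})$, $|T|=(T^*T)^{1/2}$ and $\|T\|$ is the operator norm. For $\mathbf{A}=(A_1,\ldots,A_d)$, the Euclidean operator radius is $w_e(\mathbf{A})=\sup\{(\sum_{k=1}^d|\langle A_kx,x\rangle|^2)^{1/2}:\|x\|=1\}$ and the Euclidean operator norm is $\|\mathbf{A}\|=\sup\{(\sum_{k=1}^d\|A_kx\|^2)^{1/2}:\|x\|=1\}$. Operations on tuples are componentwise: $\mathbf{A}^*=(A_1^*,\ldots,A_d^* )$, $|\mathbf{A}|^s=(|A_1|^s,\ldots,|A_d|^s)$, $|\mathbf{A}^*|^s=(|A_1^*|^s,\ldots,|A_d^*|^s)$, sums and scalar multiples are componentwise. When an exponent is $0$, $|T|^0=I$ (identity operator) and $\|T\|^0=1$.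 *)

(* Defs.v *)
From HB Require Import structures.
From mathcomp Require Import all_boot all_order all_algebra.
From mathcomp Require Import complex.
From mathcomp Require Import all_classical all_reals all_analysis.

Set Implicit Arguments.
Unset Strict Implicit.
Unset Printing Implicit Defensive.

Import Order.TTheory GRing.Theory Num.Theory numFieldNormedType.Exports.
Local Open Scope classical_set_scope.
Local Open Scope ring_scope.

(* A complex Hilbert space: a Banach space over R[i] whose norm comes from an
   inner product. The library's {dot _} forms are linear in the first argument
   and conjugate-linear in the second. *)
HB.mixin Record CompleteNormedModule_isHilbert (R : realType) H
    of CompleteNormedModule R[i] H := {
  inner : {dot H for Num.conj};
  sqr_norm_inner : forall x : H, `|x| ^+ 2 = inner x x
}.

#[short(type="hilbertType")]
HB.structure Definition Hilbert (R : realType) :=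
  {H of CompleteNormedModule R[i] H & CompleteNormedModule_isHilbert R H}.

Section BoundedOperators.
Variables (K : numFieldType) (V : normedModType K).

Definition bounded_linear : {pred V -> V} :=
  fun f => `[< linear f /\ exists M : K, forall x, `|f x| <= M * `|x| >].

Lemma bounded_linearP f :
  reflect (linear f /\ exists M : K, forall x, `|f x| <= M * `|x|)
          (f \in bounded_linear).
Proof. exact: asboolP. Qed.

Lemma bounded_linear_submod : submod_closed bounded_linear.
Proof.
split.
  apply/bounded_linearP; split=> [a u v|]; first by rewrite scaler0 addr0.
  by exists 0 => x; rewrite normr0 mul0r.
move=> a f g /bounded_linearP[lf [M fM]] /bounded_linearP[lg [N gN]].
apply/bounded_linearP; split=> [b u v|].
  rewrite !fctE /= lf lg !scalerDr !scalerA.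
  by rewrite [a * b]mulrC addrACA.
exists (`|a| * M + N) => x.
rewrite (le_trans (ler_normD _ _))// mulrDl lerD//.
by rewrite normrZ -mulrA ler_wpM2l.
Qed.

HB.instance Definition _ := GRing.isSubmodClosed.Build K (V -> V)
  bounded_linear bounded_linear_submod.

Record bounded_op := BoundedOp {
  bounded_op_fun :> V -> V;
  bounded_opP : bounded_op_fun \in bounded_linear }.

HB.instance Definition _ := [isSub for bounded_op_fun].
HB.instance Definition _ := [Choice of bounded_op by <:].
HB.instance Definition _ := [SubChoice_isSubLmodule of bounded_op by <:].

Lemma bounded_linear_id : idfun \in bounded_linear.
Proof. by apply/bounded_linearP; split=> //; exists 1 => x; rewrite mul1r. Qed.

Lemma bounded_linear_comp (S T : bounded_op) : S \o T \in bounded_linear.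
Proof.
have /bounded_linearP[lS [M SM]] := bounded_opP S.
have /bounded_linearP[lT [N TN]] := bounded_opP T.
apply/bounded_linearP; split=> [a u v|]; first by rewrite /= lT lS.
exists (`|M| * N) => x /=; rewrite (le_trans (SM _))// -mulrA.
have /ger0_norm <- : 0 <= M * `|T x| by rewrite (le_trans _ (SM _)).
by rewrite normrM normr_id ler_wpM2l.
Qed.

Definition op_id := BoundedOp bounded_linear_id.
Definition op_comp (S T : bounded_op) := BoundedOp (bounded_linear_comp S T).

Lemma bounded_op_ext (S T : bounded_op) : (forall x, S x = T x) -> S = T.
Proof. by move=> ST; apply/val_inj/funext. Qed.

Lemma bounded_op_linear (S : bounded_op) : linear S.
Proof. by have /bounded_linearP[] := bounded_opP S. Qed.

Lemma op_compA : associative op_comp.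
Proof. by move=> S T U; apply: bounded_op_ext. Qed.
Lemma op_comp1l : left_id op_id op_comp.
Proof. by move=> S; apply: bounded_op_ext. Qed.
Lemma op_comp1r : right_id op_id op_comp.
Proof. by move=> S; apply: bounded_op_ext. Qed.
Lemma op_compDl : left_distributive op_comp +%R.
Proof. by move=> S T U; apply: bounded_op_ext. Qed.
Lemma op_compDr : right_distributive op_comp +%R.
Proof.
move=> S T U; apply: bounded_op_ext => x /=.
by have := bounded_op_linear S 1 (T x) (U x); rewrite !scale1r.
Qed.

(* The product of bounded operators is composition. The ring is only a pzRingType
   because it is trivial when V is. *)
HB.instance Definition _ := GRing.Zmodule_isPzRing.Build bounded_op
  op_compA op_comp1l op_comp1r op_compDl op_compDr.

End BoundedOperators.

Section HilbertOperators.
Variables (R : realType) (H : hilbertType R).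
Implicit Types T P : bounded_op H.

(* Norms over R[i] take their (real, nonnegative) values in R[i]; rnorm is the
   same norm with values in R. It also serves as the modulus on R[i]. *)
Definition rnorm (V : normedZmodType R[i]) (x : V) : R := complex.Re `|x|.

Definition unit_sphere : set H := [set x | rnorm x = 1].

(* On the zero space the sphere is empty and sup set0 = 0, so that every operator
   has norm and radius 0. *)
Definition opnorm T : R := sup [set rnorm (T x) | x in unit_sphere].

(* The adjoint is unique, and exists by the Riesz representation theorem; the
   default value 0 of xget is never used. *)
Definition opadj T : bounded_op H :=
  xget 0 [set S : bounded_op H | forall x y, inner (T x) y = inner x (S y)].

Definition op_horner (p : {poly R}) P : bounded_op H :=
  \sum_(j < size p) (p`_j)%:C%C *: P ^+ j.

(* Continuous functional calculus f(P) of a positive operator P, whose spectrum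
   lies in [0, ||P||]: f(P) is the norm limit of p_n(P) for any polynomials p_n
   converging to f uniformly on [0, ||P||]. By the Weierstrass theorem such p_n
   exist when f is continuous there, hence f(P) is unique; the limit exists, and
   does not depend on (p_n), because ||p(P)|| <= max_[0, ||P||] |p|. *)
Definition opfun (f : R -> R) P : bounded_op H :=
  xget 0 [set Q : bounded_op H | forall p : nat -> {poly R},
    {uniform `[0, opnorm P], (fun n => horner (p n)) @ \oo --> f} ->
    (fun n => opnorm (op_horner (p n) P - Q)) @ \oo --> (0 : R)].

(* P^s for P positive and s >= 0. Since 0 `^ 0 = 1, the function is constant equal
   to 1 on [0, +oo[ when s = 0, so that P^0 is the identity. *)
Definition oppow P (s : R) : bounded_op H := opfun (fun x => x `^ s) P.

Definition opabs T : bounded_op H := oppow (opadj T * T) 2^-1.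

Definition eradius (d : nat) (A : 'I_d -> bounded_op H) : R :=
  sup [set Num.sqrt (\sum_(k < d) rnorm (inner (A k x) x) ^+ 2) | x in unit_sphere].

Definition enorm (d : nat) (A : 'I_d -> bounded_op H) : R :=
  sup [set Num.sqrt (\sum_(k < d) rnorm (A k x) ^+ 2) | x in unit_sphere].

End HilbertOperators.

(* Main.v *)
Require Import Defs.
From mathcomp Require Import all_boot all_order all_algebra.
From mathcomp Require Import complex.
From mathcomp Require Import all_classical all_reals all_analysis.
From mathcomp Require Import ring lra.
Import Order.TTheory GRing.Theory Num.Theory numFieldNormedType.Exports.
Local Open Scope classical_set_scope.
Local Open Scope ring_scope.

Set Implicit Arguments.
Unset Strict Implicit.
Unset Printing Implicit Defensive.

(** The heart of the matter is a mixed Schwarz inequality (mixed_schwarz): if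
    s, r, t >= 0 and s + r + t = 1, then
      |<A x,y>| <= |A|^t |(A* A)^(s/2) x| |(A A* )^(r/2) y|.
    It rests on the relation A f(A* A) = f(A A* ) A, which allows A to be split as
    (A A* )^(r/2) U (A* A)^(s/2) with |U| <= |A|^t, up to a shift by e > 0 that makes
    the negative powers in U meaningful. Since |A|^(2s) = (A* A)^s, taking
    s = alpha (1 - t), r = (1 - alpha) (1 - t), y = x, and using 2ab <= a^2 + b^2 to
    compare with the modulus of a + ib, gives the first inequality; the second is
    <Px,x>^2 <= <P^2 x,x> for selfadjoint P and unit x, and the third is
    |A_k| <= |(A_1, ..., A_d)|. The cases t = 1/2 and alpha = 1/2 are substitutions.

    The operators involved are defined by a choice among the objects satisfying
    their specification, so their existence has to be established. The adjoint
    comes from the Riesz representation theorem (riesz). The functional calculus of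
    a positive operator P comes from completeness, the Weierstrass theorem
    (weierstrass) and the bound |p(P)| <= max |p| over [0, |P|] (opnorm_op_horner).
    The latter is a spectral mapping argument: with l = |p(P)|, the operator
    p(P)^2 - l^2 is not bounded below; factoring p^2 - l^2 over the complex numbers
    shows that P - z is not bounded below for some root z, and positivity of P puts
    z in [0, |P|]. *)

(** * The Weierstrass approximation theorem *)

Section Weierstrass.
Variable R : realType.
Implicit Types (f : R -> R) (g : nat -> R) (x a b e : R).

(** Compactness is used through near coverings: at each point, nearby points and
    small moduli satisfy the estimate together. *)
Lemma uniformly_continuous_segment f a b : {within `[a, b], continuous f} ->
  forall e, 0 < e -> exists2 d, 0 < d &
    forall x y, x \in `[a, b] -> y \in `[a, b] -> `|x - y| < d -> `|f x - f y| < e.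
Proof.
move=> fc e e0.
have /compact_near_coveringP cov := @segment_compact R a b.
have /= [x xab|d /= d0 h] := cov R (0^'+) (fun d x => forall y,
    x \in `[a, b] -> y \in `[a, b] -> `|x - y| < d -> `|f x - f y| < e) _.
  have e20 : 0 < e / 2 by lra.
  have [r /= r0 rf] := (subspace_continuousP _ _).1 fc x xab _ (nbhsx_ballx (f x) _ e20).
  exists (ball x (r / 2), `]0, r / 2[%classic).
    split; first by apply: nbhsx_ballx; lra.
    exists (r / 2) => /=; first by lra.
    move=> z /=; rewrite sub0r normrN => zr z0.
    by rewrite in_itv/= z0 -[z]gtr0_norm.
  move=> [x' d] /= [x'x]; rewrite in_itv/= => /andP[d0 dr] y x'ab yab x'y.
  have fx' : ball (f x) (e / 2) (f x').
    by apply: rf => //=; apply: le_ball x'x; lra.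
  have fy : ball (f x) (e / 2) (f y).
    apply: rf => //=; rewrite /ball/= in x'x *.
    by rewrite (le_lt_trans (ler_distD x' _ _))//; lra.
  rewrite /ball/= in fx' fy.
  by rewrite (le_lt_trans (ler_distD (f x) _ _))// distrC; lra.
exists (d / 2) => [|x y xab yab]; first by lra.
by apply: (h (d / 2)) => //=; rewrite ?sub0r ?normrN ?gtr0_norm//; lra.
Qed.

(** The Bernstein polynomial of the values g 0, ..., g n: at x it is the mean of
    g under the binomial law of parameters n and x. The recursion conditions on
    the first trial, so that the identities below follow by induction, with no
    binomial coefficient in sight. *)
Fixpoint bernstein n g : {poly R} :=
  if n is m.+1 then (1 - 'X) * bernstein m g + 'X * bernstein m (g \o S)
  else (g 0%N)%:P.

Lemma bernsteinS n g x : (bernstein n.+1 g).[x] =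
  (1 - x) * (bernstein n g).[x] + x * (bernstein n (g \o S)).[x].
Proof. by rewrite /= !hornerE. Qed.

Lemma bernstein_ler n g1 g2 x : 0 <= x <= 1 -> (forall k, (k <= n)%N -> g1 k <= g2 k) ->
  (bernstein n g1).[x] <= (bernstein n g2).[x].
Proof.
move=> /andP[x0 x1]; elim: n g1 g2 => [|n IH] g1 g2 g12; first by rewrite !hornerE g12.
rewrite !bernsteinS lerD// ler_wpM2l ?subr_ge0// IH// => k kn; apply: g12 => //=.
exact: leqW.
Qed.

Lemma bernstein_affine n g c d x :
  (bernstein n (fun k => c * g k + d)).[x] = c * (bernstein n g).[x] + d.
Proof.
elim: n g => [|n IH] g; first by rewrite !hornerE.
rewrite !bernsteinS IH -[_ \o _]/(fun k => c * (g \o S) k + d) IH; ring.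
Qed.

(** With a = - n x this is the variance n x (1 - x) of the binomial law. *)
Lemma bernstein_variance n a x :
  (bernstein n (fun k => (k%:R + a) ^+ 2)).[x] = (n%:R * x + a) ^+ 2 + n%:R * x * (1 - x).
Proof.
elim: n a => [|n IH] a; first by rewrite !hornerE; ring.
rewrite bernsteinS IH.
have -> : (fun k : nat => (k%:R + a) ^+ 2) \o S = (fun k => (k%:R + (a + 1)) ^+ 2).
  by apply/funext => k /=; rewrite -natr1; ring.
rewrite IH -natr1; ring.
Qed.

(** Bernstein's proof: f differs from f x by at most e/2 near x and by at most a
    multiple of the squared distance elsewhere; averaging over the binomial law
    turns the square into a variance of order 1/n. *)
Theorem weierstrass f a b : a <= b -> {within `[a, b], continuous f} ->
  forall e, 0 < e -> exists p : {poly R}, forall x, x \in `[a, b] -> `|p.[x] - f x| <= e.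
Proof.
rewrite le_eqVlt => /predU1P[->|ab] fc e e0.
  exists (f b)%:P => x; rewrite in_itv/= => /andP[? ?].
  have -> : x = b by lra.
  by rewrite hornerC subrr normr0; lra.
have ab' : a <= b by lra.
have [cM cMab fM] := EVT_max ab' fc.
have [cm cmab fm] := EVT_min ab' fc.
pose D := f cM - f cm.
have e20 : 0 < e / 2 by lra.
have [d d0 fd] := uniformly_continuous_segment fc e20.
have l0 : 0 < b - a by lra.
(* D bounds the oscillation of f, hence C (y - x)^2 bounds it when |y - x| >= d. *)
pose C := D / d ^+ 2.
have D0 : 0 <= D by rewrite subr_ge0; exact: fM.
have C0 : 0 <= C by rewrite divr_ge0// sqr_ge0.
have key x y : x \in `[a, b] -> y \in `[a, b] ->
    `|f y - f x| <= e / 2 + C * (y - x) ^+ 2.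
  move=> xab yab; have [yx|yx] := ltP `|y - x| d.
    have := fd _ _ yab xab yx; have : 0 <= C * (y - x) ^+ 2 by rewrite mulr_ge0// sqr_ge0.
    by lra.
  have fD : `|f y - f x| <= D.
    rewrite ler_norml; have := fM _ xab; have := fM _ yab.
    have := fm _ xab; have := fm _ yab; rewrite /D; lra.
  have : D <= C * (y - x) ^+ 2.
    rewrite /C mulrAC ler_pdivlMr ?exprn_gt0// ler_wpM2l//.
    by rewrite -[(y - x) ^+ 2]real_normK ?num_real// lerXn2r ?nnegrE//; lra.
  by lra.
pose K := C * (b - a) ^+ 2.
have K0 : 0 <= K by rewrite mulr_ge0// sqr_ge0.
have [n n0 nK] : exists2 n : nat, 0 < n%:R :> R & K / n%:R <= e / 2.
  exists (Num.truncn (K / (e / 2))).+1; first by rewrite ltr0n.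
  by rewrite ler_pdivrMr ?ltr0n// mulrC -ler_pdivrMr//; apply/ltW/truncnS_gt.
pose g k := f (a + (b - a) * (k%:R / n%:R)).
exists (bernstein n g \Po ((b - a)^-1 *: ('X - a%:P))) => x xab.
rewrite horner_comp !hornerE; set u := _^-1 * _.
have xE : x = a + (b - a) * u by rewrite /u; field; lra.
have u01 : 0 <= u <= 1.
  move: xab; rewrite in_itv/= => /andP[ax xb].
  apply/andP; split; first by rewrite mulr_ge0 ?invr_ge0//; lra.
  by rewrite /u mulrC ler_pdivrMr//; lra.
clearbody u.
have gk k : (k <= n)%N -> `|g k - f x| <= e / 2 + (K / n%:R ^+ 2) * (k%:R + - (n%:R * u)) ^+ 2.
  move=> kn; apply: le_trans (key _ _ xab _) _.
    rewrite in_itv/=.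
    have k0 : 0 <= (k%:R / n%:R) :> R by rewrite divr_ge0.
    have k1 : (k%:R / n%:R) <= 1 :> R by rewrite ler_pdivrMr// mul1r ler_nat.
    apply/andP; split; first by rewrite lerDl mulr_ge0//; lra.
    have := ler_wpM2l (ltW l0) k1; lra.
  by rewrite le_eqVlt; apply/orP; left; apply/eqP; rewrite {1}xE /K; field; lra.
set v := n%:R * u * (1 - u) .
have /andP[u0 u1] := u01.
have v0 : 0 <= v by rewrite !mulr_ge0//; lra.
have vn : v <= n%:R.
  by rewrite /v -mulrA ler_piMr ?(ltW n0)// mulr_ile1//; lra.
have Kv : K / n%:R ^+ 2 * v <= e / 2.
  have -> : K / n%:R ^+ 2 * v = K / n%:R * (v / n%:R) by field; lra.
  apply: le_trans nK; rewrite ler_piMr ?divr_ge0 ?(ltW n0)//.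
  by rewrite ler_pdivrMr// mul1r.
pose sq k : R := (k%:R + - (n%:R * u)) ^+ 2.
have := bernstein_affine n sq (K / n%:R ^+ 2) (f x + e / 2) u.
have := bernstein_affine n sq (- (K / n%:R ^+ 2)) (f x - e / 2) u.
rewrite bernstein_variance.
have -> : (n%:R * u + - (n%:R * u)) ^+ 2 + n%:R * u * (1 - u) = v by rewrite /v; ring.
move=> lo hi; rewrite ler_distl; apply/andP; split.
  apply: (@le_trans _ _ (- (K / n%:R ^+ 2) * v + (f x - e / 2))); first by lra.
  rewrite -lo; apply: bernstein_ler => // k kn /=.
  have := gk k kn; rewrite /sq ler_distlC => /andP[]; lra.
apply: (@le_trans _ _ (K / n%:R ^+ 2 * v + (f x + e / 2))); last by lra.
rewrite -hi; apply: bernstein_ler => // k kn /=.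
have := gk k kn; rewrite /sq ler_distlC => /andP[]; lra.
Qed.

End Weierstrass.

(** * Real-valued norms and the inner product *)

Section RealNorm.
Variables (R : realType) (V : normedZmodType R[i]).
Implicit Types x y : V.

Lemma rnormE x : (rnorm x)%:C%C = `|x|.
Proof. exact: RRe_real (normr_real x). Qed.

Lemma rnorm_ge0 x : 0 <= rnorm x.
Proof. by rewrite -ler0c rnormE. Qed.

Lemma rnormN x : rnorm (- x) = rnorm x.
Proof. by rewrite /rnorm normrN. Qed.

Lemma rnorm0 : rnorm (0 : V) = 0.
Proof. by rewrite /rnorm normr0. Qed.

Lemma rnorm_eq0 x : (rnorm x == 0) = (x == 0).
Proof. by rewrite -(inj_eq (@complexI R)) rnormE normr_eq0. Qed.

Lemma rnorm_triangle x y : rnorm (x + y) <= rnorm x + rnorm y.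
Proof. by rewrite -lecR rmorphD/= !rnormE ler_normD. Qed.

Lemma rnormB x y : rnorm (x - y) = rnorm (y - x).
Proof. by rewrite /rnorm distrC. Qed.

End RealNorm.

Section Modulus.
Variable R : realType.
Implicit Types z : R[i].

Lemma rnorm_real (r : R) : rnorm r%:C%C = `|r|.
Proof. by rewrite /rnorm normc_def/= expr0n/= addr0 sqrtr_sqr. Qed.

Lemma rnorm_sqr z : rnorm z ^+ 2 = complex.Re z ^+ 2 + complex.Im z ^+ 2.
Proof. by rewrite /rnorm normc_def/= sqr_sqrtr// addr_ge0// sqr_ge0. Qed.

Lemma Re_le_rnorm z : `|complex.Re z| <= rnorm z.
Proof. by rewrite -lecR rnormE normc_ge_Re. Qed.

Lemma Im_le_rnorm z : `|complex.Im z| <= rnorm z.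
Proof.
rewrite -(@ler_pXn2r _ 2)// ?nnegrE ?rnorm_ge0// real_normK ?num_real//.
by rewrite rnorm_sqr lerDr sqr_ge0.
Qed.

End Modulus.

Section InnerProduct.
Variables (R : realType) (H : hilbertType R).
Implicit Types (x y z : H) (c : R[i]).

Lemma rnormZ c x : rnorm (c *: x) = rnorm c * rnorm x.
Proof. by apply: complexI; rewrite rmorphM/= !rnormE normrZ. Qed.

Lemma innerDl x y z : inner (x + y) z = inner x z + inner y z.
Proof. exact: linearDl. Qed.

Lemma innerDr x y z : inner x (y + z) = inner x y + inner x z.
Proof. exact: linearDr. Qed.

Lemma innerZl c x y : inner (c *: x) y = c * inner x y.
Proof. exact: linearZl_LR. Qed.

Lemma innerZr c x y : inner x (c *: y) = c^* * inner x y.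
Proof. exact: linearZr_LR. Qed.

Lemma innerNr x y : inner x (- y) = - inner x y.
Proof. exact: linearNr. Qed.

Lemma innerBl x y z : inner (x - y) z = inner x z - inner y z.
Proof. exact: linearBl. Qed.

Lemma innerBr x y z : inner x (y - z) = inner x y - inner x z.
Proof. exact: linearBr. Qed.

Lemma innerC x y : inner x y = (inner y x)^*.
Proof. by rewrite hermC expr0 mul1r. Qed.

Lemma inner_rnorm x : inner x x = (rnorm x ^+ 2)%:C%C.
Proof. by rewrite rmorphXn/= rnormE sqr_norm_inner. Qed.

Lemma Re_conj c : complex.Re c^* = complex.Re c.
Proof. by rewrite -[c^*]/(conjc c); case: c. Qed.

Lemma Im_conj c : complex.Im c^* = - complex.Im c.
Proof. by case: c. Qed.

Lemma Re_innerC x y : complex.Re (inner x y) = complex.Re (inner y x).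
Proof. by rewrite innerC Re_conj. Qed.

Lemma sqr_rnormD x y :
  rnorm (x + y) ^+ 2 = rnorm x ^+ 2 + rnorm y ^+ 2 + 2 * complex.Re (inner x y).
Proof.
have := inner_rnorm (x + y); rewrite innerDl !innerDr !inner_rnorm.
by move=> /(congr1 (@complex.Re R))/=; rewrite !raddfD/= (Re_innerC y x) => <-; ring.
Qed.

Lemma sqr_rnormB x y :
  rnorm (x - y) ^+ 2 = rnorm x ^+ 2 + rnorm y ^+ 2 - 2 * complex.Re (inner x y).
Proof. by rewrite sqr_rnormD rnormN innerNr raddfN/=; ring. Qed.

Lemma cauchy_schwarz x y : rnorm (inner x y) <= rnorm x * rnorm y.
Proof.
have [->|y0] := eqVneq y 0.
  by rewrite linear0r !rnorm0 mulr0.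
have ny0 : 0 < rnorm y by rewrite lt_neqAle eq_sym rnorm_eq0 y0 rnorm_ge0.
pose s : R := rnorm y ^+ 2.
have s0 : 0 < s by rewrite exprn_gt0.
(* Expand the squared norm of |y|^2 x - <x,y> y, which is orthogonal to y. *)
have := sqr_ge0 (rnorm (s%:C%C *: x - inner x y *: y)).
rewrite sqr_rnormB !rnormZ !exprMn rnorm_real -/s innerZl innerZr.
have -> : (inner x y)^* * inner x y = (rnorm (inner x y) ^+ 2)%:C%C.
  by rewrite rmorphXn/= rnormE mulrC -normCK.
rewrite -rmorphM/= real_normK ?num_real// => h.
rewrite -(@ler_pXn2r _ 2)// ?nnegrE ?rnorm_ge0 ?mulr_ge0 ?rnorm_ge0// exprMn -/s.
by rewrite -(ler_pM2l s0); nra.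
Qed.

End InnerProduct.

(** * Suprema over the unit sphere and the operator norm *)

Section UnitSphere.
Variables (R : realType) (H : hilbertType R).
Implicit Types (F : H -> R) (x : H).

Lemma sphere_sup_le F c : 0 <= c -> (forall x, rnorm x = 1 -> F x <= c) ->
  sup [set F x | x in @unit_sphere R H] <= c.
Proof.
move=> c0 Fc; have [->|/set0P ne] := eqVneq [set F x | x in @unit_sphere R H] set0.
  by rewrite sup0.
by apply: ge_sup => // _ [x x1 <-]; apply: Fc.
Qed.

Lemma sphere_sup_ge F c x : (forall y, rnorm y = 1 -> F y <= c) -> rnorm x = 1 ->
  F x <= sup [set F x | x in @unit_sphere R H].
Proof.
move=> Fc x1; apply: ub_le_sup; last by exists x.
by exists c => _ [y y1 <-]; apply: Fc.
Qed.

Lemma sphere_sup_ge0 F : (forall x, 0 <= F x) -> 0 <= sup [set F x | x in @unit_sphere R H].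
Proof.
move=> F0; have [->|/set0P[_ [x x1 _]]] := eqVneq [set F x | x in @unit_sphere R H] set0.
  by rewrite sup0.
have [hs|/sup_out->//] := pselect (has_sup [set F x | x in @unit_sphere R H]).
by apply: le_trans (F0 x) _; apply: sup_upper_bound => //; exists x.
Qed.

Lemma normalize x : x != 0 ->
  exists2 u : H, rnorm u = 1 & x = (rnorm x)%:C%C *: u.
Proof.
rewrite -rnorm_eq0 => x0; exists ((rnorm x)^-1%:C%C *: x).
  by rewrite rnormZ rnorm_real ger0_norm ?invr_ge0 ?rnorm_ge0// mulVf.
by rewrite scalerA -rmorphM/= divff// scale1r.
Qed.

End UnitSphere.

Section OperatorNorm.
Variables (R : realType) (H : hilbertType R).
Implicit Types (S T : bounded_op H) (x y : H) (c : R).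

Lemma opDr T x y : T (x + y) = T x + T y.
Proof. by have := bounded_op_linear T 1 x y; rewrite !scale1r. Qed.

Lemma op0r T : T 0 = 0.
Proof. by have := opDr T 0 0; rewrite addr0 -[LHS]addr0 => /addrI. Qed.

Lemma opZr T a x : T (a *: x) = a *: T x.
Proof. by have := bounded_op_linear T a x 0; rewrite op0r !addr0. Qed.

Lemma opDE S T x : (S + T) x = S x + T x. Proof. by []. Qed.
Lemma opBE S T x : (S - T) x = S x - T x. Proof. by []. Qed.
Lemma opME S T x : (S * T) x = S (T x). Proof. by []. Qed.
Lemma opZE a T x : (a *: T) x = a *: T x. Proof. by []. Qed.
Lemma op1E x : (1 : bounded_op H) x = x. Proof. by []. Qed.
Lemma op0E x : (0 : bounded_op H) x = 0. Proof. by []. Qed.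
Definition opE := (opDE, opBE, opME, opZE, op1E, op0E).

Lemma op_sumE I (r : seq I) (F : I -> bounded_op H) x :
  (\sum_(i <- r) F i) x = \sum_(i <- r) F i x.
Proof.
by elim: r => [|i r IH]; rewrite ?big_nil// !big_cons opE IH.
Qed.

Lemma op_bound T : exists c, forall x, rnorm (T x) <= c * rnorm x.
Proof.
have /bounded_linearP[_ [M TM]] := bounded_opP T.
exists (rnorm M) => x; rewrite -lecR rmorphM/= !rnormE (le_trans (TM x))//.
have /ger0_norm <- : 0 <= M * `|x| by rewrite (le_trans _ (TM x)).
by rewrite normrM normr_id.
Qed.

Lemma opnorm_ge0 T : 0 <= opnorm T.
Proof. by apply: sphere_sup_ge0 => x; apply: rnorm_ge0. Qed.

Lemma le_opnorm T x : rnorm (T x) <= opnorm T * rnorm x.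
Proof.
have [->|/normalize[u u1 ->]] := eqVneq x 0; first by rewrite op0r !rnorm0 mulr0.
rewrite opZr !rnormZ u1 mulr1 mulrC ler_wpM2r ?rnorm_ge0//.
have [c Tc] := op_bound T.
by apply: (@sphere_sup_ge _ _ (fun x => rnorm (T x)) c) => // y y1; rewrite -[c]mulr1 -y1.
Qed.

Lemma opnorm_le T c : 0 <= c -> (forall x, rnorm (T x) <= c * rnorm x) -> opnorm T <= c.
Proof.
by move=> c0 Tc; apply: sphere_sup_le => // x x1; rewrite -[c]mulr1 -x1.
Qed.

Lemma opnormD S T : opnorm (S + T) <= opnorm S + opnorm T.
Proof.
apply: opnorm_le => [|x]; first by rewrite addr_ge0 ?opnorm_ge0.
by rewrite opE (le_trans (rnorm_triangle _ _))// mulrDl lerD ?le_opnorm.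
Qed.

Lemma opnormM S T : opnorm (S * T) <= opnorm S * opnorm T.
Proof.
apply: opnorm_le => [|x]; first by rewrite mulr_ge0 ?opnorm_ge0.
by rewrite opE (le_trans (le_opnorm _ _))// -mulrA ler_wpM2l ?opnorm_ge0 ?le_opnorm.
Qed.

Lemma opnormN T : opnorm (- T) = opnorm T.
Proof.
by rewrite /opnorm; congr (sup (image _ _)); apply/funext => x; rewrite rnormN.
Qed.

Lemma opnormB S T : opnorm (S - T) = opnorm (T - S).
Proof. by rewrite -opnormN opprB. Qed.

Lemma opnorm_eq0 T : opnorm T = 0 -> T = 0.
Proof.
move=> T0; apply: bounded_op_ext => x; apply/eqP; rewrite -rnorm_eq0.
by rewrite eq_le rnorm_ge0 andbT -(mul0r (rnorm x)) -T0 le_opnorm.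
Qed.

End OperatorNorm.

(** * Completeness and the Riesz representation theorem *)

Section Riesz.
Variables (R : realType) (H : hilbertType R).
Implicit Types (u v x y : H).

Lemma harmonic_lt (K e : R) : 0 < e -> exists n : nat, K / n.+1%:R < e.
Proof.
move=> e0; exists (Num.truncn (K / e)).
by rewrite ltr_pdivrMr ?ltr0n// mulrC -ltr_pdivrMr// truncnS_gt.
Qed.

Lemma ler_add_harmonic (K a b : R) : (forall n, a <= b + K / n.+1%:R) -> a <= b.
Proof.
move=> h; apply/ler_addgt0Pr => e e0; have [n Kn] := harmonic_lt K e0.
by apply: le_trans (h n) _; rewrite lerD2l ltW.
Qed.

(** A Cauchy criterion with a prescribed rate, which the limit inherits. *)
Lemma hilbert_cvg (x : nat -> H) (K : R) :
  (forall n m, (n <= m)%N -> rnorm (x n - x m) <= K / n.+1%:R) ->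
  exists l : H, forall n, rnorm (x n - l) <= K / n.+1%:R.
Proof.
move=> xK; have /cauchy_cvg/cvg_ex[l xl] : cauchy (x @ \oo).
  apply/cauchyP => e e0.
  have eE : e = (complex.Re e)%:C%C by rewrite RRe_real// ger0_real// ltW.
  have re0 : 0 < complex.Re e by rewrite -ltcR -eE.
  have [n Kn] := harmonic_lt K re0.
  exists (x n); exists n => // m /= nm.
  rewrite -ball_normE/= -rnormE eE ltcR; exact: le_lt_trans (xK _ _ nm) Kn.
exists l => n; apply/ler_addgt0Pr => e e0.
have e0' : 0 < e%:C%C :> R[i] by rewrite ltcR.
have /cvgrPdist_lt/(_ _ e0')[N _ xN] := xl.
have := xN (maxn n N) (leq_maxr _ _); rewrite /= -rnormE ltcR => h.
have -> : x n - l = (x n - x (maxn n N)) + (x (maxn n N) - l) by rewrite addrA subrK.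
apply: le_trans (rnorm_triangle _ _) _; rewrite lerD ?xK ?leq_maxl//.
by rewrite rnormB ltW.
Qed.

(** The representing vector minimises J x = |x|^2 - 2 Re (phi x). By the
    parallelogram law every minimising sequence is Cauchy, and the first-order
    condition at the minimum u reads Re (phi v) = Re <v,u> for all v; applying it
    to i v gives the imaginary parts. *)
Lemma riesz (phi : H -> R[i]) (c : R) :
  0 <= c -> (forall a x y, phi (a *: x + y) = a * phi x + phi y) ->
  (forall x, rnorm (phi x) <= c * rnorm x) ->
  exists u, forall x, phi x = inner x u.
Proof.
move=> c0 philin phic.
have phiD x y : phi (x + y) = phi x + phi y.
  by have := philin 1 x y; rewrite scale1r mul1r.
have phi0 : phi 0 = 0 by have := phiD 0 0; rewrite addr0 -[LHS]addr0 => /addrI.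
have phiZ a x : phi (a *: x) = a * phi x by rewrite -[a *: x]addr0 philin phi0 addr0.
have phiB x y : phi (x - y) = phi x - phi y by rewrite -scaleN1r phiD phiZ mulN1r.
pose f x := complex.Re (phi x).
have fc x : `|f x| <= c * rnorm x by apply: le_trans (Re_le_rnorm _) (phic x).
have fD x y : f (x + y) = f x + f y by rewrite /f phiD raddfD.
have fB x y : f (x - y) = f x - f y by rewrite /f phiB raddfB.
have fZ (t : R) x : f (t%:C%C *: x) = t * f x.
  by rewrite /f phiZ; case: (phi x) => ? ? /=; rewrite mul0r subr0.
have ReZ (t : R) x y : complex.Re (inner (t%:C%C *: x) y) = t * complex.Re (inner x y).
  by rewrite innerZl; case: (inner x y) => ? ? /=; rewrite mul0r subr0.
pose J x := rnorm x ^+ 2 - 2 * f x.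
have Jlb x : - c ^+ 2 <= J x.
  have := fc x; rewrite ler_norml /J => /andP[_ h].
  have := sqr_ge0 (rnorm x - c); nra.
pose E := [set J x | x in [set: H]].
have infE : has_inf E.
  by split; [exists (J 0), 0 | exists (- c ^+ 2) => _ [x _ <-]].
pose m := inf E.
have mJ x : m <= J x by apply: ge_inf; [case: infE | exists x].
(* J at the midpoint of x and y is at least m. *)
have par x y : rnorm (x - y) ^+ 2 <= 2 * (J x + J y - 2 * m).
  have := mJ ((2^-1)%:C%C *: (x + y)).
  rewrite /J rnormZ exprMn rnorm_real (ger0_norm (_ : 0 <= 2^-1))// fZ fD.
  by rewrite sqr_rnormB sqr_rnormD; lra.
have /choice[x_ x_m] (n : nat) : exists x, J x < m + (n.+1%:R^-1 ^+ 2) / 4.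
  have e0 : 0 < n.+1%:R^-1 ^+ 2 / 4 :> R.
    by rewrite divr_gt0// exprn_gt0// invr_gt0 ltr0n.
  by have [_ [x _ <-] ?] := inf_adherent e0 infE; exists x.
have [u xu] : exists u, forall n, rnorm (x_ n - u) <= 1 / n.+1%:R.
  apply: hilbert_cvg => n k nk.
  rewrite -(@ler_pXn2r _ 2)// ?nnegrE ?rnorm_ge0// ?divr_ge0// mul1r.
  apply: le_trans (par _ _) _; have := x_m n; have := x_m k.
  have : (k.+1%:R^-1) ^+ 2 <= (n.+1%:R^-1 : R) ^+ 2.
    by rewrite lerXn2r ?nnegrE ?invr_ge0// lef_pV2 ?posrE ?ltr0n// ler_nat ltnS.
  by move: (k.+1%:R^-1 : R) (n.+1%:R^-1 : R) => dk dn; lra.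
have Ju : J u <= m.
  apply: (@ler_add_harmonic (2 * rnorm u + 2 * c + 4)) => n.
  set d : R := n.+1%:R^-1.
  have d0 : 0 < d by rewrite invr_gt0 ltr0n.
  have d1 : d <= 1 by rewrite invf_le1 ?ltr0n// ler1n.
  have := x_m n; rewrite -/d => xm.
  have := xu n; rewrite rnormB mul1r -/d => ud.
  have h1 : rnorm (x_ n) <= rnorm u + d.
    by rewrite -[x_ n](subrK u) addrC (le_trans (rnorm_triangle _ _))// lerD2l rnormB.
  have h2 : rnorm u <= rnorm (x_ n) + d.
    by rewrite -{1}[u](subrK (x_ n)) addrC (le_trans (rnorm_triangle _ _))// lerD2l.
  have h3 : f (x_ n) - f u <= c * d.
    rewrite -fB; have := fc (x_ n - u); rewrite ler_norml => /andP[_ h].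
    by apply: le_trans h _; rewrite ler_wpM2l// rnormB.
  rewrite /J in xm *.
  have h4 : rnorm u ^+ 2 <= (rnorm (x_ n) + d) ^+ 2.
    by rewrite lerXn2r ?nnegrE ?addr_ge0 ?rnorm_ge0// ltW.
  have h5 : d ^+ 2 <= d by rewrite expr2 ler_piMr// ltW.
  have h6 : rnorm (x_ n) * d <= (rnorm u + d) * d by rewrite ler_pM2r.
  by lra.
have Jt (t : R) v : 0 <= t * (complex.Re (inner v u) - f v) * 2 + t ^+ 2 * rnorm v ^+ 2.
  have := le_trans Ju (mJ (t%:C%C *: v + u)); rewrite /J.
  rewrite sqr_rnormD rnormZ exprMn rnorm_real real_normK ?num_real//.
  rewrite fD fZ ReZ; lra.
have fE v : f v = complex.Re (inner v u).
  have [v0|v0] := eqVneq (rnorm v) 0.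
    have /eqP -> : v == 0 by rewrite -rnorm_eq0 v0.
    by rewrite /f phi0 linear0l.
  have n0 : 0 < rnorm v ^+ 2 by rewrite exprn_gt0// lt_neqAle eq_sym v0 rnorm_ge0.
  set D := complex.Re (inner v u) - f v in Jt *.
  (* The quadratic polynomial of Jt is smallest at this t. *)
  have := Jt (- (D / rnorm v ^+ 2)) v.
  have -> : - (D / rnorm v ^+ 2) * (complex.Re (inner v u) - f v) * 2 +
    (- (D / rnorm v ^+ 2)) ^+ 2 * rnorm v ^+ 2 = - (D ^+ 2 / rnorm v ^+ 2).
    by rewrite -/D; field; lra.
  rewrite oppr_ge0 pmulr_lle0 ?invr_gt0// => D2.
  by have : D == 0; [rewrite -sqrf_eq0 eq_le D2 sqr_ge0 | rewrite /D subr_eq0 => /eqP].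
exists u => x; apply/eqP; rewrite eq_complex -/(f x) fE eqxx/=.
have := fE ('i%C *: x); rewrite /f phiZ innerZl mulrC ReiNIm mulrC ReiNIm.
by move/oppr_inj => ->.
Qed.

End Riesz.

(** * Adjoints and positive operators *)

Section Adjoint.
Variables (R : realType) (H : hilbertType R).
Implicit Types (S T : bounded_op H) (u v x y : H).

Lemma inner_ext u v : (forall x, inner x u = inner x v) -> u = v.
Proof.
move=> uv; apply/eqP; rewrite -subr_eq0 -rnorm_eq0 -sqrf_eq0.
by rewrite -(inj_eq (@complexI R)) -inner_rnorm innerBr uv subrr.
Qed.

Lemma opadj_exists T : exists S : bounded_op H, forall x y, inner (T x) y = inner x (S y).
Proof.
have /choice[S TS] (y : H) : exists u, forall x, inner (T x) y = inner x u.
  apply: (@riesz _ _ _ (opnorm T * rnorm y)).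
  - by rewrite mulr_ge0 ?opnorm_ge0 ?rnorm_ge0.
  - by move=> a x z; rewrite opDr opZr innerDl innerZl.
  move=> x; apply: le_trans (cauchy_schwarz _ _) _.
  by rewrite mulrAC ler_wpM2r ?rnorm_ge0// le_opnorm.
have Slin : linear S.
  by move=> a x y; apply: inner_ext => z; rewrite -TS innerDr innerZr !TS innerDr innerZr.
have Sbd y : rnorm (S y) <= opnorm T * rnorm y.
  have [S0|S0] := eqVneq (rnorm (S y)) 0.
    by rewrite S0 mulr_ge0 ?opnorm_ge0 ?rnorm_ge0.
  have S1 : 0 < rnorm (S y) by rewrite lt_neqAle eq_sym S0 rnorm_ge0.
  rewrite -(ler_pM2l S1) -expr2.
  have := congr1 (@complex.Re R) (inner_rnorm (S y)); rewrite -TS /= => <-.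
  apply: le_trans (le_trans (ler_norm _) (Re_le_rnorm _)) _.
  apply: le_trans (cauchy_schwarz _ _) _.
  by rewrite mulrCA mulrA ler_wpM2r ?rnorm_ge0// le_opnorm.
suff SP : S \in @bounded_linear _ H by exists (BoundedOp SP) => x y; apply: TS.
apply/bounded_linearP; split=> //; exists (opnorm T)%:C%C => y.
by rewrite -!rnormE -rmorphM/= lecR.
Qed.

Lemma opadjP T x y : inner (T x) y = inner x (opadj T y).
Proof.
have [S TS] := opadj_exists T; rewrite /opadj.
exact: (@xgetPex _ 0 [set S : bounded_op H | forall x y, inner (T x) y = inner x (S y)]
  (ex_intro _ S TS)).
Qed.

Lemma opadj_uniq T S : (forall x y, inner (T x) y = inner x (S y)) -> opadj T = S.
Proof. by move=> TS; apply: bounded_op_ext => y; apply: inner_ext => x; rewrite -opadjP. Qed.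

Lemma opadjK T : opadj (opadj T) = T.
Proof. by apply: opadj_uniq => x y; rewrite innerC -opadjP -innerC. Qed.

Lemma opadjM S T : opadj (S * T) = opadj T * opadj S.
Proof. by apply: opadj_uniq => x y; rewrite !opE !opadjP. Qed.

Lemma sqr_rnorm_op T x : rnorm (T x) ^+ 2 = complex.Re (inner ((opadj T * T) x) x).
Proof. by rewrite opE opadjP opadjK inner_rnorm. Qed.

Lemma sqr_opnorm_le T : opnorm T ^+ 2 <= opnorm (opadj T * T).
Proof.
rewrite -[leRHS]sqr_sqrtr ?opnorm_ge0// lerXn2r ?nnegrE ?opnorm_ge0 ?sqrtr_ge0//.
apply: opnorm_le => [|x]; first exact: sqrtr_ge0.
rewrite -(@ler_pXn2r _ 2)// ?nnegrE ?rnorm_ge0 ?mulr_ge0 ?sqrtr_ge0 ?rnorm_ge0//.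
rewrite exprMn sqr_sqrtr ?opnorm_ge0// sqr_rnorm_op.
apply: le_trans (le_trans (ler_norm _) (Re_le_rnorm _)) _.
apply: le_trans (cauchy_schwarz _ _) _.
by rewrite expr2 mulrA ler_wpM2r ?rnorm_ge0// le_opnorm.
Qed.

(** From |T|^2 <= |T* T| <= |T*| |T| it follows that |T| <= |T*|, and T is the
    adjoint of T*. *)
Lemma opnorm_adj T : opnorm (opadj T) = opnorm T.
Proof.
have le2 S : opnorm S <= opnorm (opadj S).
  have [->|S0] := eqVneq (opnorm S) 0; first exact: opnorm_ge0.
  have S1 : 0 < opnorm S by rewrite lt_neqAle eq_sym S0 opnorm_ge0.
  by rewrite -(ler_pM2r S1) -expr2 (le_trans (sqr_opnorm_le _))// opnormM.
by apply/eqP; rewrite eq_le le2 andbT -{2}[T]opadjK le2.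
Qed.

Lemma opnorm_adjM T : opnorm (opadj T * T) = opnorm T ^+ 2.
Proof.
apply/eqP; rewrite eq_le sqr_opnorm_le andbT (le_trans (opnormM _ _))//.
by rewrite opnorm_adj expr2.
Qed.

End Adjoint.

Section Positive.
Variables (R : realType) (H : hilbertType R).
Implicit Types (S T P : bounded_op H) (x y : H).

Definition selfadj T := forall x y, inner (T x) y = inner x (T y).

Definition positive P := selfadj P /\ forall x, 0 <= complex.Re (inner (P x) x).

Lemma selfadjE T : selfadj T -> opadj T = T.
Proof. exact: opadj_uniq. Qed.

Lemma positive_adjM T : positive (opadj T * T).
Proof.
split=> [x y|x]; last by rewrite -sqr_rnorm_op sqr_ge0.
by rewrite !opE opadjP opadjK opadjP.
Qed.

End Positive.

(** * Polynomials of an operator and approximate eigenvalues *)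

Section PolynomialCalculus.
Variables (R : realType) (H : hilbertType R).
Implicit Types (P S T : bounded_op H) (q r : {poly R[i]}) (p : {poly R}) (x : H).

Lemma op_scalerAl a S T : (a *: S) * T = a *: (S * T).
Proof. exact: bounded_op_ext. Qed.

Lemma op_scalerAr a S T : S * (a *: T) = a *: (S * T).
Proof. by apply: bounded_op_ext => x; rewrite !opE opZr. Qed.

(** Complex coefficients are required to split polynomials into linear factors. *)
Definition chorner q P : bounded_op H := \sum_(j < size q) q`_j *: P ^+ j.

Lemma chornerE n q P : (size q <= n)%N -> chorner q P = \sum_(j < n) q`_j *: P ^+ j.
Proof.
move=> qn; rewrite /chorner (big_ord_widen n (fun j => q`_j *: P ^+ j) qn) big_mkcond/=.
apply: eq_bigr => j _; case: ltnP => // qj.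
by rewrite nth_default// scale0r.
Qed.

Lemma chornerD q r P : chorner (q + r) P = chorner q P + chorner r P.
Proof.
rewrite (chornerE P (size_polyD q r)) (chornerE P (leq_maxl (size q) (size r))).
rewrite (chornerE P (leq_maxr (size q) (size r))) -big_split/=.
by apply: eq_bigr => j _; rewrite coefD scalerDl.
Qed.

Lemma chornerZ a q P : chorner (a *: q) P = a *: chorner q P.
Proof.
rewrite (chornerE P (size_scale_leq a q)) scaler_sumr.
by apply: eq_bigr => j _; rewrite coefZ scalerA.
Qed.

Lemma chornerC a P : chorner a%:P P = a *: (1 : bounded_op H).
Proof. by rewrite (chornerE P (size_polyC_leq1 a)) big_ord1 coefC expr0. Qed.

Lemma chornerMX q P : chorner (q * 'X) P = chorner q P * P.
Proof.
have [->|q0] := eqVneq q 0; first by rewrite mul0r /chorner size_poly0 !big_ord0 mul0r.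
rewrite /chorner size_mulX// big_ord_recl coefMX/= scale0r add0r mulr_suml.
by apply: eq_bigr => j _; rewrite coefMX/= exprSr op_scalerAl.
Qed.

Lemma chornerXM q P : P * chorner q P = chorner q P * P.
Proof.
rewrite mulr_suml mulr_sumr; apply: eq_bigr => j _.
by rewrite op_scalerAl op_scalerAr -exprS exprSr.
Qed.

Lemma chornerM q r P : chorner (q * r) P = chorner q P * chorner r P.
Proof.
elim/poly_ind: q r => [|q a IH] r.
  by rewrite mul0r /chorner size_poly0 !big_ord0 mul0r.
rewrite mulrDl -mulrA ['X * _]mulrC chornerD IH chornerMX chornerD chornerMX chornerC.
by rewrite mul_polyC chornerZ mulrDl -chornerXM mulrA op_scalerAl mul1r.
Qed.

Definition ofreal p : {poly R[i]} := map_poly (real_complex R) p.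

Lemma op_hornerE p P : op_horner p P = chorner (ofreal p) P.
Proof.
rewrite /op_horner /chorner /ofreal size_map_poly; apply: eq_bigr => j _.
by rewrite coef_map.
Qed.

Lemma op_hornerD p p' P : op_horner (p + p') P = op_horner p P + op_horner p' P.
Proof. by rewrite !op_hornerE /ofreal rmorphD chornerD. Qed.

Lemma op_hornerZ a p P : op_horner (a *: p) P = a%:C%C *: op_horner p P.
Proof. by rewrite !op_hornerE /ofreal map_polyZ/= chornerZ. Qed.

Lemma op_hornerB p p' P : op_horner (p - p') P = op_horner p P - op_horner p' P.
Proof.
by rewrite -scaleN1r op_hornerD op_hornerZ rmorphN1 scaleN1r.
Qed.

Lemma op_hornerM p p' P : op_horner (p * p') P = op_horner p P * op_horner p' P.
Proof. by rewrite !op_hornerE /ofreal rmorphM chornerM. Qed.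

Lemma op_hornerC a P : op_horner a%:P P = a%:C%C *: (1 : bounded_op H).
Proof. by rewrite op_hornerE /ofreal map_polyC chornerC. Qed.

Lemma op_hornerX P : op_horner 'X P = P.
Proof. by rewrite op_hornerE /ofreal map_polyX -['X]mul1r chornerMX chornerC scale1r mul1r. Qed.

Lemma intertwine_op_horner S P T p : S * P = T * S ->
  S * op_horner p P = op_horner p T * S.
Proof.
move=> SPT; rewrite mulr_suml mulr_sumr; apply: eq_bigr => j _.
rewrite op_scalerAl op_scalerAr; congr (_ *: _).
elim: (nat_of_ord j) => [|k IH]; first by rewrite !expr0 mulr1 mul1r.
by rewrite !exprSr mulrA IH -mulrA SPT mulrA.
Qed.

Lemma selfadj_op_horner P p : selfadj P -> selfadj (op_horner p P).
Proof.
move=> P_sa x y; rewrite !op_sumE.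
elim/big_ind2: _ => [|u1 u2 v1 v2 h1 h2|j _].
- by rewrite linear0l linear0r.
- by rewrite innerDl innerDr h1 h2.
rewrite !opE innerZl innerZr; congr (_ * _).
  by rewrite -[_^*]/(conjc _) conjc_real.
elim: (nat_of_ord j) x y => [|k IH] x y; first by rewrite !expr0 !opE.
by rewrite [in LHS]exprS exprSr !opE P_sa IH.
Qed.

(** The operators T - z that are not bounded below are those for which z is an
    approximate eigenvalue of T. *)
Definition bounded_below T := exists2 c : R, 0 < c & forall x, c * rnorm x <= rnorm (T x).

Lemma bounded_belowM S T : bounded_below S -> bounded_below T -> bounded_below (S * T).
Proof.
move=> [c c0 Sc] [d d0 Td]; exists (c * d) => [|x]; first by rewrite mulr_gt0.
by rewrite opE -mulrA (le_trans _ (Sc _))// ler_pM2l.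
Qed.

Lemma bounded_belowZ a : a != 0 -> bounded_below (a *: (1 : bounded_op H)).
Proof.
move=> a0; exists (rnorm a) => [|x]; last by rewrite !opE rnormZ.
by rewrite lt_neqAle eq_sym rnorm_eq0 a0 rnorm_ge0.
Qed.

(** The spectral mapping step: q(P) is a product of factors P - z over the roots
    z of q, and a product of operators bounded below is bounded below. *)
Lemma not_bounded_below_root q P : q != 0 -> ~ bounded_below (chorner q P) ->
  exists2 z, root q z & ~ bounded_below (P - z *: (1 : bounded_op H)).
Proof.
move=> q0 nq; apply: contrapT => h; apply: nq.
have [s qE] := closed_field_poly_normal q.
have bz z : z \in s -> bounded_below (P - z *: (1 : bounded_op H)).
  move=> zs; apply: contrapT => nz; apply: h; exists z => //.
  by rewrite qE rootZ ?lead_coef_eq0// root_prod_XsubC.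
rewrite qE chornerZ -[chorner _ P]mul1r -op_scalerAl; apply: bounded_belowM.
  by apply: bounded_belowZ; rewrite lead_coef_eq0.
elim: s bz {qE} => [|z s IH] bz.
  by rewrite big_nil chornerC scale1r; exists 1 => // x; rewrite mul1r.
rewrite big_cons chornerM; apply: bounded_belowM.
  rewrite chornerD -['X]mul1r chornerMX -polyCN !chornerC scale1r mul1r scaleNr.
  by apply: bz; rewrite mem_head.
by apply: IH => y ys; apply: bz; rewrite inE ys orbT.
Qed.

(** The numerical range of P lies in [0, |P|], so P - z is bounded below by |Im z|
    and, for real z, by the distance from z to that segment. *)
Lemma approximate_eigenvalue_positive P z : positive P ->
  ~ bounded_below (P - z *: (1 : bounded_op H)) ->
  exists2 a : R, z = a%:C%C & 0 <= a <= opnorm P.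
Proof.
move=> [P_sa P_pos] nz.
(* A functional g dominated by the modulus that is at least c on the numerical
   range of P - z would make P - z bounded below; g is taken to be |Im|, Re and
   - Re in turn. *)
have num (g : R[i] -> R) c : 0 < c -> (forall w, g w <= rnorm w) ->
    (forall x, c * rnorm x ^+ 2 <= g (inner ((P - z *: (1 : bounded_op H)) x) x)) -> False.
  move=> c0 gle cg; apply: nz; exists c => // x.
  have [x0|x0] := eqVneq (rnorm x) 0; first by rewrite x0 mulr0 rnorm_ge0.
  have x1 : 0 < rnorm x by rewrite lt_neqAle eq_sym x0 rnorm_ge0.
  rewrite -(ler_pM2r x1) -mulrA -expr2 (le_trans (cg x))// (le_trans (gle _))//.
  exact: cauchy_schwarz.
have inP x : exists r : R, inner (P x) x = r%:C%C.
  exists (complex.Re (inner (P x) x)).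
  have := Im_conj (inner (P x) x); rewrite -innerC -P_sa.
  by case: (inner (P x) x) => u v /= h; congr (_ +i* _)%C; lra.
have inz x : inner ((P - z *: (1 : bounded_op H)) x) x =
    (complex.Re (inner (P x) x))%:C%C - z * (rnorm x ^+ 2)%:C%C.
  by rewrite !opE innerBl innerZl inner_rnorm; have [r ->] := inP x.
have Imz : complex.Im z = 0.
  apply/eqP/negPn/negP => z0.
  apply: (num (fun w => `|complex.Im w|) `|complex.Im z|) => [||x].
  - by rewrite normr_gt0.
  - exact: Im_le_rnorm.
  by rewrite inz; case: (z) => u v /=; rewrite mulr0 !add0r normrN normrM (ger0_norm (sqr_ge0 _)).
have zE : z = (complex.Re z)%:C%C by case: z Imz {nz num inz} => u v /= ->.
exists (complex.Re z) => //; apply/andP; split.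
  rewrite leNgt; apply/negP => z0.
  apply: (num (@complex.Re R) (- complex.Re z)) => [|w|x]; first by rewrite oppr_gt0.
    exact: le_trans (ler_norm _) (Re_le_rnorm _).
  rewrite inz {2}zE -rmorphM -rmorphB/=; have := P_pos x; lra.
rewrite leNgt; apply/negP => z0.
apply: (num (fun w => - complex.Re w) (complex.Re z - opnorm P)) => [|w|x].
- by rewrite subr_gt0.
- by rewrite (le_trans _ (Re_le_rnorm w))// lerNl lerNnormlW.
rewrite inz {2}zE -rmorphM -rmorphB/=.
have : complex.Re (inner (P x) x) <= opnorm P * rnorm x ^+ 2.
  apply: le_trans (le_trans (ler_norm _) (Re_le_rnorm _)) _.
  by rewrite (le_trans (cauchy_schwarz _ _))// expr2 mulrA ler_wpM2r ?rnorm_ge0 ?le_opnorm.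
lra.
Qed.

End PolynomialCalculus.

(** * Limits of polynomials of a positive operator *)

Section Calculus.
Variables (R : realType) (H : hilbertType R).
Implicit Types (P S T Q A : bounded_op H) (p : {poly R}) (f g : R -> R) (x : H) (e : R).

(** If x has norm 1 then |S^2 x - l^2 x|^2 <= l^2 (l^2 - |S x|^2), which tends to 0
    along a sequence realising the norm l of S. *)
Lemma sqr_opnorm_approximate_eigenvalue S (l := opnorm S) :
  selfadj S -> 0 < l -> ~ bounded_below (S * S - (l ^+ 2)%:C%C *: (1 : bounded_op H)).
Proof.
move=> S_sa l0 [c c0 hc].
(* A lower bound c for S^2 - l^2 would force |S x|^2 <= k |x|^2 with k < l^2. *)
pose k := Num.max 0 (l ^+ 2 - c ^+ 2 / l ^+ 2).
have k0 : 0 <= k by rewrite le_max lexx.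
have l20 : 0 < l ^+ 2 by rewrite exprn_gt0.
suff : l ^+ 2 <= k.
  rewrite /k le_max => /orP[|]; first by rewrite leNgt l20.
  by rewrite lerBrDr gerDl leNgt divr_gt0// exprn_gt0.
suff lk : l <= Num.sqrt k.
  by rewrite -[leRHS]sqr_sqrtr// lerXn2r// nnegrE ?sqrtr_ge0// ltW.
apply: opnorm_le => [|x]; first exact: sqrtr_ge0.
rewrite -(@ler_pXn2r _ 2)// ?nnegrE ?rnorm_ge0 ?mulr_ge0 ?sqrtr_ge0 ?rnorm_ge0//.
rewrite exprMn sqr_sqrtr//.
have h1 : c ^+ 2 * rnorm x ^+ 2 <= rnorm ((S * S - (l ^+ 2)%:C%C *: (1 : bounded_op H)) x) ^+ 2.
  by rewrite -exprMn lerXn2r ?nnegrE ?mulr_ge0 ?rnorm_ge0// ltW.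
have h2 : complex.Re (inner ((l ^+ 2)%:C%C *: x) (S (S x))) = l ^+ 2 * rnorm (S x) ^+ 2.
  by rewrite innerZl -S_sa inner_rnorm -rmorphM.
have h3 : rnorm (S (S x)) ^+ 2 <= l ^+ 2 * rnorm (S x) ^+ 2.
  by rewrite -exprMn lerXn2r ?nnegrE ?mulr_ge0 ?opnorm_ge0 ?rnorm_ge0// le_opnorm.
move: h1; rewrite !opE rnormB sqr_rnormB h2 rnormZ rnorm_real (ger0_norm (ltW l20)).
rewrite exprMn => h1.
apply: (@le_trans _ _ ((l ^+ 2 - c ^+ 2 / l ^+ 2) * rnorm x ^+ 2)); last first.
  by rewrite ler_wpM2r ?sqr_ge0// le_max lexx orbT.
rewrite -(ler_pM2l l20).
have -> : l ^+ 2 * ((l ^+ 2 - c ^+ 2 / l ^+ 2) * rnorm x ^+ 2) =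
  l ^+ 2 * l ^+ 2 * rnorm x ^+ 2 - c ^+ 2 * rnorm x ^+ 2 by field; lra.
rewrite -expr2; lra.
Qed.

(** The norm l of p(P) makes p^2 - l^2 vanish at some approximate eigenvalue of P,
    which lies in [0, |P|]; so l is a value of |p| there. *)
Lemma opnorm_op_horner P p e : positive P ->
  (forall u, u \in `[0, opnorm P] -> `|p.[u]| <= e) -> opnorm (op_horner p P) <= e.
Proof.
move=> P_pos pe; rewrite leNgt; apply/negP => el.
set l := opnorm _ in el.
have in0 : 0 \in `[0, opnorm P] by rewrite in_itv/= lexx opnorm_ge0.
have e0 : 0 <= e := le_trans (normr_ge0 _) (pe _ in0).
have l0 : 0 < l by apply: le_lt_trans el.
pose r := p * p - (l ^+ 2)%:P.
suff [u u01 /eqP] : exists2 u, u \in `[0, opnorm P] & r.[u] = 0.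
  rewrite !hornerE subr_eq0 -expr2 => /eqP pl.
  have : l ^+ 2 <= e ^+ 2.
    by rewrite -pl -[leLHS]real_normK ?num_real// lerXn2r ?nnegrE// pe.
  by rewrite ler_pXn2r ?nnegrE ?(ltW l0)// leNgt el.
have [->|r0] := eqVneq r 0; first by exists 0; rewrite ?horner0.
have [||z rz] := @not_bounded_below_root _ _ (ofreal r) P.
- by rewrite map_poly_eq0.
- rewrite -op_hornerE op_hornerB op_hornerM op_hornerC.
  by apply: sqr_opnorm_approximate_eigenvalue => //; apply: selfadj_op_horner; case: P_pos.
case/(approximate_eigenvalue_positive P_pos) => a zE a01; exists a; first by rewrite in_itv.
by apply: complexI; rewrite -horner_map/= -zE; apply/eqP.
Qed.

(** calc P f Q says that Q is f(P). The relation is the closure of the graph of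
    p |-> p(P), for the uniform norm on [0, |P|] and the operator norm, so that
    every property of polynomials stable under limits passes to it without any
    choice of approximating sequence. *)
Definition calc P f Q := forall e, 0 < e -> exists2 p : {poly R},
  (forall u, u \in `[0, opnorm P] -> `|p.[u] - f u| <= e) & opnorm (op_horner p P - Q) <= e.

(** The bound on polynomials, transported to limits; uniqueness of f(P) and the norm
    bound for f(P) are special cases. *)
Lemma calc_lipschitz P f g S T e : positive P -> calc P f S -> calc P g T ->
  (forall u, u \in `[0, opnorm P] -> `|f u - g u| <= e) -> opnorm (S - T) <= e.
Proof.
move=> P_pos fS gT fg; apply/ler_addgt0Pr => d d0.
have d40 : 0 < d / 4 by lra.
have [p pf pS] := fS _ d40; have [q qg qT] := gT _ d40.
have pq : opnorm (op_horner (p - q) P) <= e + d / 4 + d / 4.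
  apply: opnorm_op_horner => // u u0; rewrite !hornerE.
  have := pf u u0; have := qg u u0; have := fg u u0.
  by rewrite !ler_norml => /andP[? ?] /andP[? ?] /andP[? ?]; lra.
rewrite op_hornerB in pq.
have -> : S - T = (S - op_horner p P) + (op_horner p P - op_horner q P + (op_horner q P - T)).
  by rewrite !subrKA.
have := opnormD (op_horner p P - op_horner q P) (op_horner q P - T).
have := opnormD (S - op_horner p P) (op_horner p P - op_horner q P + (op_horner q P - T)).
rewrite [opnorm (S - _)]opnormB; lra.
Qed.

Lemma calc_closed P f Q : (forall e, 0 < e -> exists g T, [/\ calc P g T,
    (forall u, u \in `[0, opnorm P] -> `|g u - f u| <= e) & opnorm (T - Q) <= e]) ->
  calc P f Q.
Proof.
move=> h e e0; have e20 : 0 < e / 2 by lra.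
have [g [T [gT gf TQ]]] := h _ e20; have [p pg pT] := gT _ e20; exists p => [u u0|].
  by have := pg u u0; have := gf u u0; rewrite !ler_norml => /andP[? ?] /andP[? ?]; lra.
have -> : op_horner p P - Q = (op_horner p P - T) + (T - Q) by rewrite subrKA.
by rewrite (le_trans (opnormD _ _))//; lra.
Qed.

Lemma calc_eq P f g Q : {in `[0, opnorm P], f =1 g} -> calc P f Q -> calc P g Q.
Proof.
move=> fg fQ e e0; have [p pf pQ] := fQ e e0; exists p => // u u0.
by rewrite -fg// pf.
Qed.

Lemma calc_uniq P f S T : positive P -> calc P f S -> calc P f T -> S = T.
Proof.
move=> P_pos fS fT; apply/eqP; rewrite -subr_eq0; apply/eqP/opnorm_eq0/eqP.
rewrite eq_le opnorm_ge0 andbT; apply: (calc_lipschitz P_pos fS fT) => u _.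
by rewrite subrr normr0.
Qed.

Lemma calc_horner P p : calc P (horner p) (op_horner p P).
Proof.
have opnorm0 : opnorm (0 : bounded_op H) = 0.
  apply/eqP; rewrite eq_le opnorm_ge0 andbT; apply: opnorm_le => // x.
  by rewrite rnorm0 mul0r.
by move=> e e0; exists p => [u _|]; rewrite subrr ?normr0 ?opnorm0 ltW.
Qed.

Lemma calcC P (c : R) : calc P (fun=> c) (c%:C%C *: (1 : bounded_op H)).
Proof.
have := @calc_horner P c%:P; rewrite op_hornerC.
by apply: calc_eq => u _; rewrite hornerC.
Qed.

Lemma calc_id P : calc P id P.
Proof.
by have := @calc_horner P 'X; rewrite op_hornerX; apply: calc_eq => u _; rewrite hornerX.
Qed.

Lemma calc_norm P f S e : positive P -> calc P f S ->
  (forall u, u \in `[0, opnorm P] -> `|f u| <= e) -> opnorm S <= e.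
Proof.
move=> P_pos fS fe; have := calc_lipschitz P_pos fS (calcC P 0).
by rewrite scale0r subr0; apply => u u0; rewrite subr0 fe.
Qed.

Lemma calcD P f g S T : calc P f S -> calc P g T -> calc P (f \+ g) (S + T).
Proof.
move=> fS gT e e0; have e20 : 0 < e / 2 by lra.
have [p pf pS] := fS _ e20; have [q qg qT] := gT _ e20; exists (p + q) => [u u0|].
  have := pf u u0; have := qg u u0; rewrite !hornerE/=.
  by rewrite !ler_norml => /andP[? ?] /andP[? ?]; lra.
by rewrite op_hornerD opprD addrACA (le_trans (opnormD _ _))//; lra.
Qed.

Lemma calc_bounded P f S : calc P f S ->
  exists M, forall u, u \in `[0, opnorm P] -> `|f u| <= M.
Proof.
move=> fS; have [p pf _] := fS 1 ltr01.
suff [M pM] : exists M, forall u, u \in `[0, opnorm P] -> `|p.[u]| <= M.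
  exists (M + 1) => u u0; have := pf u u0; have := pM u u0.
  by rewrite !ler_norml => /andP[? ?] /andP[? ?]; lra.
exists (\sum_(i < size p) `|p`_i| * opnorm P ^+ i) => u; rewrite in_itv/= => /andP[u0 u1].
rewrite horner_coef (le_trans (ler_norm_sum _ _ _))// ler_sum// => i _.
by rewrite normrM normrX (ger0_norm u0) ler_wpM2l// lerXn2r// nnegrE// opnorm_ge0.
Qed.

Lemma calcM P f g S T : calc P f S -> calc P g T -> calc P (f \* g) (S * T).
Proof.
move=> fS gT e e0.
have [M fM] := calc_bounded fS; have [N gN] := calc_bounded gT.
have in0 : 0 \in `[0, opnorm P] by rewrite in_itv/= lexx opnorm_ge0.
have M0 := le_trans (normr_ge0 _) (fM _ in0); have N0 := le_trans (normr_ge0 _) (gN _ in0).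
pose K := M + N + opnorm S + opnorm T + 1.
have S0 := opnorm_ge0 S; have T0 := opnorm_ge0 T.
have K1 : 1 <= K by rewrite /K; lra.
have [d d0 [d1 dK]] : exists2 d, 0 < d & d <= 1 /\ d * K <= e.
  exists (Num.min 1 (e / K)); first by rewrite lt_min ltr01 divr_gt0//; lra.
  split; first by rewrite ge_min lexx.
  by rewrite -ler_pdivlMr ?ge_min ?lexx ?orbT//; lra.
have [p pf pS] := fS _ d0; have [q qg qT] := gT _ d0; exists (p * q) => [u u0|].
  have := pf u u0; have := qg u u0; have := fM u u0; have := gN u u0; rewrite !hornerE/=.
  have -> : p.[u] * q.[u] - f u * g u =
    (p.[u] - f u) * (q.[u] - g u) + (p.[u] - f u) * g u + f u * (q.[u] - g u) by ring.
  move=> g1 f1 q1 p1; apply: le_trans (ler_normD _ _) _.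
  have := ler_normD ((p.[u] - f u) * (q.[u] - g u)) ((p.[u] - f u) * g u).
  rewrite !normrM => h1; have h2 := ler_pM (normr_ge0 _) (normr_ge0 _) p1 q1.
  have h3 := ler_pM (normr_ge0 _) (normr_ge0 _) p1 g1.
  have h4 := ler_pM (normr_ge0 _) (normr_ge0 _) f1 q1.
  have h5 : d * d <= d by rewrite ler_piMr// ltW.
  have h6 : 0 <= d * (opnorm S + opnorm T) by rewrite mulr_ge0//; lra.
  by rewrite /K in dK; lra.
rewrite op_hornerM; set U := op_horner p P in pS *; set V := op_horner q P in qT *.
have -> : U * V - S * T = (U - S) * (V - T) + ((U - S) * T + S * (V - T)).
  by rewrite addrA -mulrDr subrK mulrBl mulrBr subrKA.
have h1 := opnormD ((U - S) * (V - T)) ((U - S) * T + S * (V - T)).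
have h2 := opnormD ((U - S) * T) (S * (V - T)).
have h3 := le_trans (opnormM (U - S) (V - T)) (ler_pM (opnorm_ge0 _) (opnorm_ge0 _) pS qT).
have h4 := le_trans (opnormM (U - S) T) (ler_wpM2r T0 pS).
have h5 := le_trans (opnormM S (V - T)) (ler_wpM2l S0 qT).
have h6 : d * d <= d by rewrite ler_piMr// ltW.
have h7 : 0 <= d * (M + N) by rewrite mulr_ge0//; lra.
by rewrite /K in dK; lra.
Qed.

Lemma calc_comp_poly P g Q p : calc P g Q -> calc P (fun u => p.[g u]) (op_horner p Q).
Proof.
move=> gQ; elim/poly_ind: p => [|p c IH].
  rewrite -[op_horner 0 Q]scale1r -polyC0 op_hornerC scale1r.
  by have := calcC P 0; apply: calc_eq => u _; rewrite !hornerE.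
rewrite op_hornerD op_hornerM op_hornerX op_hornerC.
have := calcD (calcM IH gQ) (calcC P c).
by apply: calc_eq => u _; rewrite /= !hornerE.
Qed.

(** It suffices to replace f by a polynomial close to it on [0, |Q|]. *)
Lemma calc_comp P f g Q S : positive P -> positive Q ->
  (forall u, u \in `[0, opnorm P] -> g u \in `[0, opnorm Q]) ->
  calc P g Q -> calc Q f S -> calc P (f \o g) S.
Proof.
move=> P_pos Q_pos gPQ gQ fS; apply: calc_closed => e e0.
have [p pf pS] := fS e e0.
exists (fun u => p.[g u]), (op_horner p Q); split => //; first exact: calc_comp_poly.
by move=> u u0; apply/pf/gPQ.
Qed.

(** A p(P) = p(P') A for polynomials; equality of the norms lets the same
    polynomials approximate f for both operators. *)
Lemma calc_intertwine A P P' f S S' : opnorm P = opnorm P' -> A * P = P' * A ->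
  positive P -> positive P' -> calc P f S -> calc P' f S' -> A * S = S' * A.
Proof.
move=> PP' AP P_pos P'_pos fS fS'; apply/eqP; rewrite -subr_eq0; apply/eqP/opnorm_eq0/eqP.
rewrite eq_le opnorm_ge0 andbT; apply/ler_addgt0Pr => d d0; rewrite add0r.
have A0 := opnorm_ge0 A.
pose e := d / (3 * opnorm A + 1).
have e0 : 0 < e by rewrite divr_gt0//; lra.
have eA : e * (3 * opnorm A + 1) = d by rewrite /e mulfVK//; lra.
have [p pf pS] := fS _ e0.
have pS' : opnorm (op_horner p P' - S') <= e + e.
  apply: calc_lipschitz P'_pos (@calc_horner P' p) fS' _ => u; rewrite -PP' => u0.
  by apply: le_trans (pf u u0) _; lra.
rewrite opnormB in pS.
have -> : A * S - S' * A = A * (S - op_horner p P) + (op_horner p P' - S') * A.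
  by rewrite mulrBr mulrBl (intertwine_op_horner _ AP) subrKA.
have h1 := opnormD (A * (S - op_horner p P)) ((op_horner p P' - S') * A).
have h2 := le_trans (opnormM A (S - op_horner p P)) (ler_wpM2l A0 pS).
have h3 := le_trans (opnormM (op_horner p P' - S') A) (ler_wpM2r A0 pS').
lra.
Qed.

Lemma calc_selfadj P f S : selfadj P -> calc P f S -> selfadj S.
Proof.
move=> P_sa fS x y.
apply/eqP; rewrite -subr_eq0 -rnorm_eq0 eq_le rnorm_ge0 andbT.
apply/ler_addgt0Pr => d d0; rewrite add0r.
pose K := 2 * (rnorm x * rnorm y) + 1.
have xy0 : 0 <= rnorm x * rnorm y by rewrite mulr_ge0 ?rnorm_ge0.
have e0 : 0 < d / K by rewrite divr_gt0// /K; lra.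
have [p _ pS] := fS _ e0; set U := op_horner p P in pS.
have U_sa : selfadj U by apply: selfadj_op_horner.
have -> : inner (S x) y - inner x (S y) = inner x ((U - S) y) - inner ((U - S) x) y.
  by rewrite !opE innerBl innerBr U_sa opprB [RHS]addrC subrKA.
apply: le_trans (rnorm_triangle _ _) _; rewrite rnormN.
have h1 : rnorm (inner x ((U - S) y)) <= d / K * (rnorm x * rnorm y).
  rewrite (le_trans (cauchy_schwarz _ _))// mulrCA ler_wpM2l ?rnorm_ge0//.
  by rewrite (le_trans (le_opnorm _ _))// ler_wpM2r ?rnorm_ge0.
have h2 : rnorm (inner ((U - S) x) y) <= d / K * (rnorm x * rnorm y).
  rewrite (le_trans (cauchy_schwarz _ _))// mulrA ler_wpM2r ?rnorm_ge0//.
  by rewrite (le_trans (le_opnorm _ _))// ler_wpM2r ?rnorm_ge0.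
have : d / K * K = d by rewrite mulfVK// /K; lra.
by rewrite {2}/K; lra.
Qed.

End Calculus.

(** * The continuous functional calculus *)

Section FunctionalCalculus.
Variables (R : realType) (H : hilbertType R).
Implicit Types (P S T Q : bounded_op H) (f g : R -> R) (x : H).

Lemma bounded_op_cvg (U : nat -> bounded_op H) :
  (forall n m, (n <= m)%N -> opnorm (U n - U m) <= 1 / n.+1%:R) ->
  exists Q : bounded_op H, forall n, opnorm (U n - Q) <= 1 / n.+1%:R.
Proof.
move=> UC.
have /choice[Q UQ] (x : H) : exists l : H, forall n, rnorm (U n x - l) <= rnorm x / n.+1%:R.
  apply: hilbert_cvg => n m nm.
  by rewrite -opBE (le_trans (le_opnorm _ _))// mulrC ler_wpM2l ?rnorm_ge0// -div1r UC.
have Qlin : linear Q.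
  move=> a x y; apply/eqP; rewrite -subr_eq0 -rnorm_eq0 eq_le rnorm_ge0 andbT.
  apply: (@ler_add_harmonic _ (rnorm (a *: x + y) + (rnorm a * rnorm x + rnorm y))) => n.
  rewrite add0r.
  have -> : Q (a *: x + y) - (a *: Q x + Q y) =
      (a *: (U n x - Q x) + (U n y - Q y)) - (U n (a *: x + y) - Q (a *: x + y)).
    by rewrite opDr opZr scalerBr addrACA -opprD [in RHS]opprB [RHS]addrC subrKA.
  have h1 := rnorm_triangle (a *: (U n x - Q x) + (U n y - Q y))
    (- (U n (a *: x + y) - Q (a *: x + y))).
  have h2 := rnorm_triangle (a *: (U n x - Q x)) (U n y - Q y).
  have h3 := UQ (a *: x + y) n; have h4 := UQ y n.
  have := ler_wpM2l (rnorm_ge0 a) (UQ x n); rewrite -rnormZ => h5.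
  rewrite rnormN in h1; rewrite !mulrDl.
  by move: h1 h2 h3 h4 h5; move: (n.+1%:R^-1 : R) => dn; lra.
have QU n x : rnorm ((U n x) - Q x) <= 1 / n.+1%:R * rnorm x by rewrite mulrAC mul1r UQ.
suff QP : Q \in @bounded_linear _ H.
  by exists (BoundedOp QP) => n; apply: opnorm_le => [|x]; [rewrite divr_ge0 | exact: QU].
apply/bounded_linearP; split=> //; exists (opnorm (U 0%N) + 1)%:C%C => x.
rewrite -!rnormE -rmorphM/= lecR mulrDl.
rewrite -[Q x](subKr (U 0%N x)) (le_trans (rnorm_triangle _ _))// lerD ?le_opnorm//.
by rewrite rnormN (le_trans (QU _ _))// divr1.
Qed.

Lemma calc_exists P f : positive P -> {within `[0, opnorm P], continuous f} ->
  exists Q, calc P f Q.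
Proof.
move=> P_pos fc.
have /choice[p pf] (n : nat) : exists p : {poly R}, forall u, u \in `[0, opnorm P] ->
    `|p.[u] - f u| <= 1 / n.+1%:R / 2.
  by apply: weierstrass => //; rewrite ?opnorm_ge0// !divr_gt0// ltr0n.
have [n m nm|Q pQ] := @bounded_op_cvg (fun n => op_horner (p n) P).
  apply: calc_lipschitz P_pos (@calc_horner _ _ P (p n)) (@calc_horner _ _ P (p m)) _ => u u0.
  have := pf n u u0; have := pf m u u0.
  have : 1 / m.+1%:R <= 1 / n.+1%:R :> R.
    by rewrite !div1r lef_pV2 ?posrE ?ltr0n// ler_nat ltnS.
  move: (1 / m.+1%:R : R) (1 / n.+1%:R : R) => a b.
  by rewrite !ler_norml => ? /andP[? ?] /andP[? ?]; lra.
exists Q => e e0; have [n ne] := harmonic_lt 1 e0; exists (p n) => [u u0|].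
  have := pf n u u0; have : 0 <= 1 / n.+1%:R :> R by rewrite divr_ge0.
  by move: (1 / n.+1%:R : R) ne => b; lra.
by rewrite (le_trans (pQ n))// ltW.
Qed.

Lemma uniform_segmentP (p : nat -> {poly R}) f (b : R) :
  {uniform `[0, b], (fun n => horner (p n)) @ \oo --> f} <->
  forall e, 0 < e -> \forall n \near \oo, forall u, u \in `[0, b] -> `|(p n).[u] - f u| <= e.
Proof.
split=> [pf e e0|pf W /uniform_nbhs[E [entE EW]]].
  have := pf [set h | forall u, u \in `[0, b] -> `|h u - f u| <= e]; apply.
  apply/uniform_nbhs; exists [set xy | ball xy.1 e xy.2]; split.
    by rewrite -entourage_ballE; exists e.
  by move=> h /= hf u u0; have := hf u u0; rewrite /ball/= distrC => /ltW.
move: entE; rewrite -entourage_ballE => -[e /= e0 eE].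
have e20 : 0 < e / 2 by lra.
have := pf _ e20; apply: filterS => n pn; apply: EW => u u0; apply: eE.
by rewrite /= /ball/= distrC (le_lt_trans (pn u u0))//; lra.
Qed.

(** Links the relation calc with opfun, which is defined by sequences of
    polynomials and xget. *)
Lemma calcP P f Q : positive P -> calc P f Q -> opfun f P = Q.
Proof.
move=> P_pos fQ; rewrite /opfun.
set E := (X in xget _ X).
have EQ : E Q.
  move=> p /uniform_segmentP pf; apply/cvgr0Pnorm_le => e e0.
  have := pf _ e0; apply: filterS => n pn.
  rewrite ger0_norm ?opnorm_ge0//.
  exact: calc_lipschitz P_pos (@calc_horner _ _ P (p n)) fQ _.
have := xgetPex 0 (ex_intro _ Q EQ); move: (xget 0 E) => Q'; move=> {EQ} Q'P; rewrite {}/E/= in Q'P.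
have /choice[p pf] (n : nat) : exists p : {poly R},
    (forall u, u \in `[0, opnorm P] -> `|p.[u] - f u| <= 1 / n.+1%:R) /\
    opnorm (op_horner p P - Q) <= 1 / n.+1%:R.
  have [|p p1 p2] := fQ (1 / n.+1%:R); last by exists p.
  by rewrite divr_gt0// ltr0n.
have : {uniform `[0, opnorm P], (fun n => horner (p n)) @ \oo --> f}.
  apply/uniform_segmentP => e e0; have [N Ne] := harmonic_lt 1 e0.
  exists N => // n /= Nn u u0; rewrite (le_trans ((pf n).1 u u0))// (le_trans _ (ltW Ne))//.
  by rewrite !div1r lef_pV2 ?posrE ?ltr0n// ler_nat ltnS.
move=> /Q'P/cvgr0Pnorm_lt Q'0.
apply/eqP; rewrite -subr_eq0; apply/eqP/opnorm_eq0/eqP.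
rewrite eq_le opnorm_ge0 andbT; apply/ler_addgt0Pr => e e0; rewrite add0r.
have e20 : 0 < e / 2 by lra.
have [N _ NQ'] := Q'0 _ e20; have [M Me] := harmonic_lt 1 e20.
pose n := maxn N M.
have h1 := NQ' n (leq_maxl _ _).
rewrite /= ger0_norm ?opnorm_ge0// in h1.
have h2 : opnorm (op_horner (p n) P - Q) <= e / 2.
  rewrite (le_trans (pf n).2)// (le_trans _ (ltW Me))//.
  by rewrite !div1r lef_pV2 ?posrE ?ltr0n// ler_nat ltnS leq_maxr.
have := opnormD (Q' - op_horner (p n) P) (op_horner (p n) P - Q).
rewrite subrKA [opnorm (Q' - op_horner _ _)]opnormB; lra.
Qed.

Lemma continuous_powR (s b : R) : 0 <= s -> 0 < b ->
  {within `[0, b], continuous (fun u : R => u `^ s)}.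
Proof.
rewrite le_eqVlt => /predU1P[<-|s0] b0.
  have -> : (fun u : R => u `^ 0) = fun=> 1 by apply/funext => u; rewrite powRr0.
  by apply: continuous_subspaceT => u; apply: cvg_cst.
have pc (x : R) : 0 < x -> {for x, continuous (fun u : R => u `^ s)}.
  move=> x0; apply/differentiable_continuous/derivable1_diffP.
  by apply: derivable_powR; rewrite in_itv/= x0.
apply/continuous_within_itvP => //; split.
- by move=> x; rewrite in_itv/= => /andP[x0 _]; apply: pc.
- by rewrite powR0 ?gt_eqF//; exact: powR_cvg0.
- by apply: cvg_at_left_filter; apply: pc.
Qed.

Lemma calc_oppow P s : positive P -> 0 <= s -> calc P (fun u => u `^ s) (oppow P s).
Proof.
move=> P_pos s0; have [|Q fQ] := @calc_exists P (fun u => u `^ s) P_pos.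
  apply: (@continuous_subspaceW _ _ _ `[0, opnorm P + 1]%classic).
    by move=> u /=; rewrite !in_itv/= => /andP[-> ?]; lra.
  by apply: continuous_powR => //; have := opnorm_ge0 P; lra.
by rewrite /oppow (calcP P_pos fQ).
Qed.

(** The exponent s may be negative, since u + e stays away from 0. *)
Lemma calc_shifted_powR P s e : positive P -> 0 < e ->
  exists Q, calc P (fun u => (u + e) `^ s) Q.
Proof.
move=> P_pos e0; apply: calc_exists => //.
apply: continuous_in_subspaceT => u; rewrite inE/= in_itv/= => /andP[u0 _].
apply/differentiable_continuous/derivable1_diffP.
apply: diff_derivable; apply: (@differentiable_comp _ _ _ _ (fun v => v + e) (fun v => v `^ s)).
  exact: differentiableD.
by apply/derivable1_diffP/derivable_powR; rewrite in_itv/= andbT; lra.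
Qed.

End FunctionalCalculus.

(** * Powers of positive operators and the mixed Schwarz inequality *)

Section Powers.
Variables (R : realType) (H : hilbertType R).
Implicit Types (P S T Q A : bounded_op H) (x y : H) (s r t u b e : R).

(** Valid also at u = 0, where 0 `^ 0 = 1. *)
Lemma ge0_powRD u s r : 0 <= s -> 0 <= r -> u `^ (s + r) = u `^ s * u `^ r.
Proof.
move=> s0 r0; have [->|u0] := eqVneq u 0; last by rewrite powRD// u0 implybT.
have [->|s1] := eqVneq s 0; first by rewrite add0r powRr0 mul1r.
by rewrite (powR0 s1) mul0r powR0// paddr_eq0// negb_and s1.
Qed.

Lemma oppowM P s r : positive P -> 0 <= s -> 0 <= r ->
  oppow P s * oppow P r = oppow P (s + r).
Proof.
move=> P_pos s0 r0; have sr0 : 0 <= s + r by rewrite addr_ge0.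
apply: (calc_uniq P_pos _ (calc_oppow P_pos sr0)).
have := calcM (calc_oppow P_pos s0) (calc_oppow P_pos r0).
by apply: calc_eq => u _ /=; rewrite ge0_powRD.
Qed.

Lemma oppow_selfadj P s : positive P -> 0 <= s -> selfadj (oppow P s).
Proof. by move=> P_pos s0; apply: (calc_selfadj _ (calc_oppow P_pos s0)); case: P_pos. Qed.

Lemma oppow_sqr P s : positive P -> 0 <= s ->
  oppow P s = oppow P (s / 2) * oppow P (s / 2).
Proof. by move=> P_pos s0; rewrite oppowM ?divr_ge0// -splitr. Qed.

Lemma inner_oppow P s x : positive P -> 0 <= s ->
  inner (oppow P s x) x = (rnorm (oppow P (s / 2) x) ^+ 2)%:C%C.
Proof.
by move=> P_pos s0; rewrite oppow_sqr// opE oppow_selfadj ?divr_ge0// inner_rnorm.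
Qed.

Lemma positive_oppow P s : positive P -> 0 <= s -> positive (oppow P s).
Proof.
move=> P_pos s0; split; first exact: oppow_selfadj.
by move=> x; rewrite inner_oppow//= sqr_ge0.
Qed.

Lemma oppow1 P : positive P -> oppow P 1 = P.
Proof.
move=> P_pos; apply: (calc_uniq P_pos (calc_oppow P_pos ler01) _).
have := calc_id P; apply: calc_eq => u; rewrite in_itv/= => /andP[u0 _].
by rewrite powRr1.
Qed.

(** The square root maps [0, |P|] into [0, |Q|] for Q = P^(1/2), since |Q|^2 = |P|. *)
Lemma oppow_sqrt P s : positive P -> 0 <= s ->
  oppow (oppow P 2^-1) s = oppow P (2^-1 * s).
Proof.
move=> P_pos s0; have h0 : 0 <= 2^-1 :> R by [].
have hs0 : 0 <= 2^-1 * s by rewrite mulr_ge0.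
have Q_pos := positive_oppow P_pos h0.
have Qn : opnorm (oppow P 2^-1) ^+ 2 = opnorm P.
  rewrite -opnorm_adjM selfadjE; last exact: oppow_selfadj.
  by rewrite oppowM// -[2^-1]div1r -splitr oppow1.
apply: (calc_uniq P_pos _ (calc_oppow P_pos hs0)).
have := calc_comp P_pos Q_pos _ (calc_oppow P_pos h0) (calc_oppow Q_pos s0).
move=> /(_ _)/calc_eq; apply.
  by move=> u _ /=; rewrite powRrM.
move=> u; rewrite !in_itv/= => /andP[u0 uP]; rewrite powR12_sqrt// sqrtr_ge0/=.
by rewrite -(@ler_pXn2r _ 2)// ?nnegrE ?sqrtr_ge0 ?opnorm_ge0// sqr_sqrtr// Qn.
Qed.

Lemma shifted_powR_close s b e : 0 <= s -> 0 <= b -> 0 < e ->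
  exists2 d, 0 < d & forall d', 0 < d' -> d' < d ->
    forall u, u \in `[0, b] -> `|(u + d') `^ s - u `^ s| <= e.
Proof.
move=> s0 b0 e0; have b1 : 0 < b + 1 by lra.
have [d d0 hd] := uniformly_continuous_segment (continuous_powR s0 b1) e0.
exists (Num.min d 1); first by rewrite lt_min d0 ltr01.
move=> d' d'0; rewrite lt_min => /andP[d'd d'1] u; rewrite in_itv/= => /andP[u0 ub].
apply/ltW/hd; rewrite ?in_itv/= ?u0/=; [|lra|].
  by apply/andP; split; lra.
by rewrite addrAC subrr add0r gtr0_norm.
Qed.

(** The mixed Schwarz inequality with N + e and M + e in place of N = A* A and
    M = A A*, so that negative powers exist. Write
    A = A (N+e)^(r/2) (N+e)^(-(s+r)/2) (N+e)^(s/2); since A N = M A, the factor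
    (N+e)^(r/2) moves to the left of A as (M+e)^(r/2), then to the other side of
    the inner product. What remains is the norm of A (N+e)^(-(s+r)/2), whose square
    is at most the maximum of u (u+e)^(-(s+r)) <= u^t over [0, |A|^2]. *)
Lemma mixed_schwarz_shifted A s r t e x y (N := opadj A * A) (M := A * opadj A)
    (G K : bounded_op H) : 0 <= s -> 0 <= r -> 0 <= t -> s + r + t = 1 -> 0 < e ->
  calc N (fun u => (u + e) `^ (s / 2)) G -> calc M (fun u => (u + e) `^ (r / 2)) K ->
  rnorm (inner (A x) y) <= opnorm A `^ t * rnorm (G x) * rnorm (K y).
Proof.
move=> s0 r0 t0 srt e0 GN KM.
have N_pos : positive N by apply: positive_adjM.
have M_pos : positive M by rewrite /M -{1}(opadjK A); apply: positive_adjM.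
have Nn : opnorm N = opnorm A ^+ 2 by apply: opnorm_adjM.
have NM : opnorm N = opnorm M.
  by rewrite Nn /M -{2}(opadjK A) opnorm_adjM opnorm_adj.
have [L LN] := calc_shifted_powR (r / 2) N_pos e0.
have [V VN] := calc_shifted_powR (- ((s + r) / 2)) N_pos e0.
have ALK : A * L = K * A by apply: calc_intertwine NM _ N_pos M_pos LN KM; rewrite mulrA.
have LVG : L * (V * G) = 1.
  rewrite -[RHS]scale1r; apply: (calc_uniq N_pos _ (calcC N 1)).
  have := calcM LN (calcM VN GN); apply: calc_eq => u; rewrite in_itv/= => /andP[u0 _].
  have ue : u + e != 0 by rewrite gt_eqF//; lra.
  rewrite /= -!powRD ?ue ?implybT//.
  by rewrite (_ : r / 2 + _ = 0) ?powRr0//; field.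
(* |A V|^2 = |V N V|, and V N V is a function of N. *)
have AV : opnorm (A * V) <= opnorm A `^ t.
  rewrite -(@ler_pXn2r _ 2)// ?nnegrE ?opnorm_ge0 ?powR_ge0// -opnorm_adjM opadjM.
  rewrite (selfadjE (calc_selfadj N_pos.1 VN)) mulrA -[V * _ * A]mulrA -/N.
  apply: (calc_norm N_pos (calcM (calcM VN (calc_id N)) VN)) => u.
  rewrite in_itv/= => /andP[u0 uN] /=.
  have ue : u + e != 0 by rewrite gt_eqF//; lra.
  rewrite mulrAC -powRD ?ue ?implybT// -opprD -splitr powRN.
  have sr0 : 0 <= s + r by rewrite addr_ge0.
  have ue0 : 0 < (u + e) `^ (s + r) by rewrite powR_gt0//; lra.
  rewrite ger0_norm ?mulr_ge0 ?invr_ge0 ?powR_ge0// mulrC ler_pdivrMr//.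
  have uE : u = u `^ t * u `^ (s + r) by rewrite -ge0_powRD// addrC srt powRr1.
  have le1 : u `^ (s + r) <= (u + e) `^ (s + r).
    by apply: ge0_ler_powR; rewrite ?nnegrE//; lra.
  have le2 : u `^ t <= (opnorm A `^ t) ^+ 2.
    rewrite expr2 -powRM ?opnorm_ge0// -expr2 -Nn.
    by apply: ge0_ler_powR; rewrite ?nnegrE// opnorm_ge0.
  by rewrite [leLHS]uE ler_pM ?powR_ge0.
have -> : inner (A x) y = inner ((A * V) (G x)) (K y).
  have <- : selfadj K := calc_selfadj M_pos.1 KM.
  by rewrite -[x in LHS]op1E -LVG -!opME !mulrA -ALK.
apply: le_trans (cauchy_schwarz _ _) _; rewrite ler_wpM2r ?rnorm_ge0//.
by rewrite (le_trans (le_opnorm _ _))// ler_wpM2r ?rnorm_ge0.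
Qed.

(** Letting e tend to 0 in the shifted inequality: (u + e)^s tends to u^s uniformly
    on segments, even for s = 0. *)
Lemma mixed_schwarz A s r t x y : 0 <= s -> 0 <= r -> 0 <= t -> s + r + t = 1 ->
  rnorm (inner (A x) y) <= opnorm A `^ t *
    rnorm (oppow (opadj A * A) (s / 2) x) * rnorm (oppow (A * opadj A) (r / 2) y).
Proof.
move=> s0 r0 t0 srt; set N := opadj A * A; set M := A * opadj A.
have N_pos : positive N by apply: positive_adjM.
have M_pos : positive M by rewrite /M -{1}(opadjK A); apply: positive_adjM.
have s20 : 0 <= s / 2 by rewrite divr_ge0.
have r20 : 0 <= r / 2 by rewrite divr_ge0.
have close e : 0 < e -> rnorm (inner (A x) y) <= opnorm A `^ t *
    (rnorm (oppow N (s / 2) x) + e * rnorm x) * (rnorm (oppow M (r / 2) y) + e * rnorm y).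
  move=> e0.
  have [d1 d10 h1] := shifted_powR_close s20 (opnorm_ge0 N) e0.
  have [d2 d20 h2] := shifted_powR_close r20 (opnorm_ge0 M) e0.
  have [d [d0 dd1 dd2]] : exists d, [/\ 0 < d, d < d1 & d < d2].
    exists (Num.min d1 d2 / 2); have : 0 < Num.min d1 d2 by rewrite lt_min d10.
    have : Num.min d1 d2 <= d1 by rewrite ge_min lexx.
    have : Num.min d1 d2 <= d2 by rewrite ge_min lexx orbT.
    by move: (Num.min d1 d2) => m m2 m1 m0; split; lra.
  have [G GN] := calc_shifted_powR (s / 2) N_pos d0.
  have [K KM] := calc_shifted_powR (r / 2) M_pos d0.
  apply: le_trans (mixed_schwarz_shifted x y s0 r0 t0 srt d0 GN KM) _.
  have near T T' z : opnorm (T - T') <= e -> rnorm (T z) <= rnorm (T' z) + e * rnorm z.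
    move=> TT'; rewrite -[T z](subrK (T' z)) addrC (le_trans (rnorm_triangle _ _))// lerD2l.
    by rewrite -opBE (le_trans (le_opnorm _ _))// ler_wpM2r ?rnorm_ge0.
  rewrite ler_pM ?mulr_ge0 ?powR_ge0 ?rnorm_ge0//.
    rewrite ler_wpM2l ?powR_ge0//; apply: near.
    exact: (calc_lipschitz N_pos GN (calc_oppow N_pos s20) (h1 _ d0 dd1)).
  apply: near; exact: (calc_lipschitz M_pos KM (calc_oppow M_pos r20) (h2 _ d0 dd2)).
have c0 := powR_ge0 (opnorm A) t; have x0 := rnorm_ge0 x; have y0 := rnorm_ge0 y.
have p0 := rnorm_ge0 (oppow N (s / 2) x); have q0 := rnorm_ge0 (oppow M (r / 2) y).
move: (opnorm A `^ t) (rnorm (oppow N _ x)) (rnorm (oppow M _ y)) c0 p0 q0 close.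
move: (rnorm x) (rnorm y) (rnorm (inner _ _)) x0 y0 => X Y B X0 Y0 c p q c0 p0 q0 close.
apply: (@ler_add_harmonic _ (c * (p * Y + q * X + X * Y))) => n.
have d0 : 0 < n.+1%:R^-1 :> R by rewrite invr_gt0 ltr0n.
have d1 : n.+1%:R^-1 <= 1 :> R by rewrite invf_le1 ?ltr0n// ler1n.
move: (n.+1%:R^-1 : R) d0 d1 => d d0 d1.
apply: le_trans (close _ d0) _.
have -> : c * (p + d * X) * (q + d * Y) =
  c * p * q + c * (p * Y + q * X + d * (X * Y)) * d by ring.
by rewrite lerD2l ler_wpM2r ?(ltW d0)// ler_wpM2l// lerD2l ler_piMl ?mulr_ge0.
Qed.

End Powers.

(** * Euclidean operator radius inequalities *)

Section EuclideanRadius.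
Variables (R : realType) (H : hilbertType R) (d : nat).
Implicit Types (A B : 'I_d -> bounded_op H) (T : bounded_op H) (x : H).

Lemma opabs_positive T : positive (opabs T).
Proof. by apply: positive_oppow => //; apply: positive_adjM. Qed.

Lemma oppow_opabs T (s : R) : 0 <= s -> oppow (opabs T) s = oppow (opadj T * T) (2^-1 * s).
Proof. by move=> s0; apply: oppow_sqrt => //; apply: positive_adjM. Qed.

Lemma sqrt_le (a c : R) : 0 <= c -> a <= c ^+ 2 -> Num.sqrt a <= c.
Proof. by move=> c0 ac; rewrite -[c]ger0_norm// -sqrtr_sqr ler_wsqrtr. Qed.

Lemma rnorm_inner_le T x : rnorm x = 1 -> rnorm (inner (T x) x) <= opnorm T.
Proof.
move=> x1; rewrite (le_trans (cauchy_schwarz _ _))// x1 mulr1.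
by rewrite (le_trans (le_opnorm _ _))// x1 mulr1.
Qed.

Lemma le_eradius A x : rnorm x = 1 ->
  \sum_(k < d) rnorm (inner (A k x) x) ^+ 2 <= eradius A ^+ 2.
Proof.
move=> x1; have S0 y : 0 <= \sum_(k < d) rnorm (inner (A k y) y) ^+ 2.
  by apply: sumr_ge0 => k _; apply: sqr_ge0.
rewrite -[leLHS]sqr_sqrtr// lerXn2r ?nnegrE ?sqrtr_ge0//.
  by apply: sphere_sup_ge0 => y; apply: sqrtr_ge0.
apply: (@sphere_sup_ge _ _ (fun x => Num.sqrt (\sum_(k < d) rnorm (inner (A k x) x) ^+ 2))
  (Num.sqrt (\sum_(k < d) opnorm (A k) ^+ 2)) x) => // y y1.
rewrite ler_wsqrtr// ler_sum// => k _.
by rewrite lerXn2r ?nnegrE ?rnorm_ge0 ?opnorm_ge0// rnorm_inner_le.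
Qed.

Lemma eradius_ge0 A : 0 <= eradius A.
Proof. by apply: sphere_sup_ge0 => y; apply: sqrtr_ge0. Qed.

Lemma eradius_le A (c : R) : 0 <= c -> (forall x, rnorm x = 1 ->
  \sum_(k < d) rnorm (inner (A k x) x) ^+ 2 <= c ^+ 2) -> eradius A <= c.
Proof. by move=> c0 Ac; apply: sphere_sup_le => // x x1; apply: sqrt_le => //; apply: Ac. Qed.

Lemma opnorm_le_enorm A k : opnorm (A k) <= enorm A.
Proof.
apply: sphere_sup_le => [|x x1]; first by apply: sphere_sup_ge0 => y; apply: sqrtr_ge0.
have S0 y : 0 <= \sum_(j < d) rnorm (A j y) ^+ 2.
  by apply: sumr_ge0 => j _; apply: sqr_ge0.
apply: (@le_trans _ _ (Num.sqrt (\sum_(j < d) rnorm (A j x) ^+ 2))).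
  rewrite -[leLHS]ger0_norm ?rnorm_ge0// -sqrtr_sqr ler_wsqrtr//.
  by rewrite (bigD1 k)//= lerDl sumr_ge0// => j _; apply: sqr_ge0.
apply: (@sphere_sup_ge _ _ (fun x => Num.sqrt (\sum_(j < d) rnorm (A j x) ^+ 2))
  (Num.sqrt (\sum_(j < d) opnorm (A j) ^+ 2)) x) => // y y1.
rewrite ler_wsqrtr// ler_sum// => j _; rewrite lerXn2r ?nnegrE ?rnorm_ge0 ?opnorm_ge0//.
by rewrite (le_trans (le_opnorm _ _))// y1 mulr1.
Qed.

(** For selfadjoint P and Q the numbers <Px,x> and <Qx,x> are the real and
    imaginary parts of <(P + iQ)x,x>. *)
Lemma sqr_rnorm_inner_addi (P Q : bounded_op H) x (p q : R) :
  inner (P x) x = p%:C%C -> inner (Q x) x = q%:C%C ->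
  rnorm (inner ((P + 'i%C *: Q) x) x) ^+ 2 = p ^+ 2 + q ^+ 2.
Proof.
move=> Pp Qq; rewrite !opE innerDl innerZl Pp Qq rnorm_sqr; congr (_ ^+ 2 + _ ^+ 2) => /=; ring.
Qed.

Variables (A : 'I_d -> bounded_op H) (alpha t : R).
Hypotheses (alpha01 : 0 <= alpha <= 1) (t01 : 0 <= t <= 1).

Let c := 1 / Num.sqrt 2 * \big[Num.max/0]_(k < d) (opnorm (A k) `^ t) : R.
Let B k := oppow (opabs (A k)) (2 * alpha * (1 - t)) +
  'i%C *: oppow (opabs (opadj (A k))) (2 * (1 - alpha) * (1 - t)).
Let C := \sum_(k < d) (oppow (opabs (A k)) (4 * alpha * (1 - t)) +
  oppow (opabs (opadj (A k))) (4 * (1 - alpha) * (1 - t))).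

Let max_ge0 : 0 <= \big[Num.max/0]_(k < d) (opnorm (A k) `^ t).
Proof. exact: bigmax_ge_id. Qed.

Let c_ge0 : 0 <= c.
Proof. by rewrite mulr_ge0// divr_ge0// sqrtr_ge0. Qed.

Let exp_ge0 : 0 <= alpha * (1 - t) /\ 0 <= (1 - alpha) * (1 - t).
Proof. by case/andP: alpha01 => ? ?; case/andP: t01 => ? ?; rewrite !mulr_ge0//; lra. Qed.

(** For a unit vector x, mixed_schwarz with exponents s = alpha (1 - t) and
    r = (1 - alpha) (1 - t) bounds |<A_k x,x>|^2 by |A_k|^(2t) a b, where a and b are
    the diagonal values of the positive operators (A_k* A_k)^s and (A_k A_k* )^r;
    then a b <= (a^2 + b^2) / 2 and a^2 + b^2 = |<B_k x,x>|^2. *)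
Lemma eradius_le_max_eradius : eradius A <= c * eradius B.
Proof.
have [s0 r0] := exp_ge0.
apply: eradius_le => [|x x1]; first by rewrite mulr_ge0 ?eradius_ge0.
rewrite exprMn; apply: (le_trans _ (ler_wpM2l (sqr_ge0 c) (le_eradius B x1))).
rewrite mulr_sumr; apply: ler_sum => k _.
set N := opadj (A k) * A k; set M := A k * opadj (A k).
have N_pos : positive N by apply: positive_adjM.
have M_pos : positive M by rewrite /M -{1}(opadjK (A k)); apply: positive_adjM.
set s := alpha * (1 - t); set r := (1 - alpha) * (1 - t).
pose p := rnorm (oppow N (s / 2) x); pose q := rnorm (oppow M (r / 2) x).
have s20 : 0 <= 2 * alpha * (1 - t) by rewrite -mulrA mulr_ge0.
have r20 : 0 <= 2 * (1 - alpha) * (1 - t) by rewrite -mulrA mulr_ge0.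
have Ns : oppow (opabs (A k)) (2 * alpha * (1 - t)) = oppow N s.
  by rewrite (oppow_opabs _ s20); congr oppow; rewrite /s; field.
have Mr : oppow (opabs (opadj (A k))) (2 * (1 - alpha) * (1 - t)) = oppow M r.
  by rewrite (oppow_opabs _ r20) opadjK; congr oppow; rewrite /r; field.
have -> : rnorm (inner (B k x) x) ^+ 2 = (p ^+ 2) ^+ 2 + (q ^+ 2) ^+ 2.
  by apply: sqr_rnorm_inner_addi; rewrite ?Ns ?Mr inner_oppow.
have srt : s + r + t = 1 by rewrite /s /r; ring.
have /andP[t0 _] := t01.
have := mixed_schwarz (A k) x x s0 r0 t0 srt; rewrite -/N -/M -/p -/q => h.
have pq0 : 0 <= p * q by rewrite mulr_ge0 ?rnorm_ge0.
have cE : c ^+ 2 = 2^-1 * (\big[Num.max/0]_(k < d) (opnorm (A k) `^ t)) ^+ 2.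
  by rewrite exprMn div1r exprVn sqr_sqrtr.
have ak : opnorm (A k) `^ t <= \big[Num.max/0]_(k < d) (opnorm (A k) `^ t).
  exact: (le_bigmax _ (fun k => opnorm (A k) `^ t)).
apply: (@le_trans _ _ ((opnorm (A k) `^ t * (p * q)) ^+ 2)).
  rewrite lerXn2r ?nnegrE ?rnorm_ge0 ?mulr_ge0 ?powR_ge0 ?rnorm_ge0//.
  by rewrite mulrA.
have m2 : (opnorm (A k) `^ t) ^+ 2 <= (\big[Num.max/0]_(k < d) (opnorm (A k) `^ t)) ^+ 2.
  by rewrite lerXn2r ?nnegrE ?powR_ge0.
have pq2 : (p * q) ^+ 2 <= 2^-1 * ((p ^+ 2) ^+ 2 + (q ^+ 2) ^+ 2).
  have := sqr_ge0 (p ^+ 2 - q ^+ 2); nra.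
rewrite [leLHS]exprMn cE [2^-1 * _ ^+ 2]mulrC -[leRHS]mulrA.
exact: ler_pM (sqr_ge0 _) (sqr_ge0 _) m2 pq2.
Qed.

(** <Px,x>^2 <= |Px|^2 = <P^2 x,x> for P selfadjoint and x a unit vector, summed
    over all the operators. *)
Lemma max_eradius_le_opnorm : c * eradius B <= c * Num.sqrt (opnorm C).
Proof.
have [s0 r0] := exp_ge0; rewrite ler_wpM2l//.
apply: eradius_le => [|x x1]; first exact: sqrtr_ge0.
rewrite sqr_sqrtr ?opnorm_ge0//.
have Re_le (w : R[i]) : complex.Re w <= rnorm w := le_trans (ler_norm _) (Re_le_rnorm w).
apply: le_trans (le_trans (Re_le _) (rnorm_inner_le C x1)).
have -> : inner (C x) x = \sum_(k < d)
   inner ((oppow (opabs (A k)) (4 * alpha * (1 - t)) +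
  oppow (opabs (opadj (A k))) (4 * (1 - alpha) * (1 - t))) x) x.
  rewrite op_sumE; elim/big_ind2: _ => [|u w u' w' uw uw'|//]; first exact: linear0l.
  by rewrite innerDl uw uw'.
rewrite raddf_sum. apply: ler_sum => k _. 
have key P s : positive P -> 0 <= s -> exists2 p : R, inner (oppow P (2 * s) x) x = p%:C%C
    & p ^+ 2 <= complex.Re (inner (oppow P (4 * s) x) x).
  move=> P_pos se0; have s20 : 0 <= 2 * s by rewrite mulr_ge0.
  exists (rnorm (oppow P (2 * s / 2) x) ^+ 2); first exact: inner_oppow.
  rewrite inner_oppow ?mulr_ge0//= lerXn2r ?nnegrE ?sqr_ge0 ?rnorm_ge0//.
  rewrite (_ : 4 * s / 2 = 2 * s); last by field.
  have := cauchy_schwarz (oppow P (2 * s) x) x.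
  by rewrite x1 mulr1 inner_oppow// rnorm_real ger0_norm// sqr_ge0.
have [p pE p2] := key _ _ (opabs_positive (A k)) s0.
have [q qE q2] := key _ _ (opabs_positive (opadj (A k))) r0.
rewrite !mulrA in pE p2 qE q2.
rewrite (sqr_rnorm_inner_addi pE qE) opE innerDl raddfD/=.
by apply: (lerD p2 q2).
Qed.

Lemma max_opnorm_le_enorm :
  c * Num.sqrt (opnorm C) <= 1 / Num.sqrt 2 * (enorm A `^ t) * Num.sqrt (opnorm C).
Proof.
rewrite ler_wpM2r ?sqrtr_ge0// ler_wpM2l ?divr_ge0 ?sqrtr_ge0//.
apply: bigmax_le => [|k _]; first exact: powR_ge0.
have /andP[t0 _] := t01.
apply: ge0_ler_powR; rewrite ?nnegrE ?opnorm_ge0//; last exact: opnorm_le_enorm.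
exact: le_trans (opnorm_ge0 _) (opnorm_le_enorm A k).
Qed.

End EuclideanRadius.

(** * The three chains of inequalities *)

Theorem mainTheorem1 (R : realType) (H : hilbertType R) (d : nat)
    (hd : (1 <= d)%N) (A : 'I_d -> bounded_op H) :
  (* (i) *)
  (forall alpha t : R, 0 <= alpha <= 1 -> 0 <= t <= 1 ->
    [/\ eradius A <=
          1 / Num.sqrt 2 * \big[Num.max/0]_(k < d) (opnorm (A k) `^ t) *
          eradius (fun k =>
            oppow (opabs (A k)) (2 * alpha * (1 - t)) +
            'i%C *: oppow (opabs (opadj (A k))) (2 * (1 - alpha) * (1 - t))),
        1 / Num.sqrt 2 * \big[Num.max/0]_(k < d) (opnorm (A k) `^ t) *
          eradius (fun k =>
            oppow (opabs (A k)) (2 * alpha * (1 - t)) +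
            'i%C *: oppow (opabs (opadj (A k))) (2 * (1 - alpha) * (1 - t))) <=
          1 / Num.sqrt 2 * \big[Num.max/0]_(k < d) (opnorm (A k) `^ t) *
          Num.sqrt (opnorm (\sum_(k < d)
            (oppow (opabs (A k)) (4 * alpha * (1 - t)) +
             oppow (opabs (opadj (A k))) (4 * (1 - alpha) * (1 - t)))))
      & 1 / Num.sqrt 2 * \big[Num.max/0]_(k < d) (opnorm (A k) `^ t) *
          Num.sqrt (opnorm (\sum_(k < d)
            (oppow (opabs (A k)) (4 * alpha * (1 - t)) +
             oppow (opabs (opadj (A k))) (4 * (1 - alpha) * (1 - t))))) <=
          1 / Num.sqrt 2 * (enorm A `^ t) *
          Num.sqrt (opnorm (\sum_(k < d)
            (oppow (opabs (A k)) (4 * alpha * (1 - t)) +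
             oppow (opabs (opadj (A k))) (4 * (1 - alpha) * (1 - t)))))])
  /\
  (* (ii) *)
  (forall alpha : R, 0 <= alpha <= 1 ->
    [/\ eradius A <=
          1 / Num.sqrt 2 * \big[Num.max/0]_(k < d) (opnorm (A k) `^ 2^-1) *
          eradius (fun k =>
            oppow (opabs (A k)) alpha +
            'i%C *: oppow (opabs (opadj (A k))) (1 - alpha)),
        1 / Num.sqrt 2 * \big[Num.max/0]_(k < d) (opnorm (A k) `^ 2^-1) *
          eradius (fun k =>
            oppow (opabs (A k)) alpha +
            'i%C *: oppow (opabs (opadj (A k))) (1 - alpha)) <=
          1 / Num.sqrt 2 * \big[Num.max/0]_(k < d) (opnorm (A k) `^ 2^-1) *
          Num.sqrt (opnorm (\sum_(k < d)
            (oppow (opabs (A k)) (2 * alpha) +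
             oppow (opabs (opadj (A k))) (2 * (1 - alpha)))))
      & 1 / Num.sqrt 2 * \big[Num.max/0]_(k < d) (opnorm (A k) `^ 2^-1) *
          Num.sqrt (opnorm (\sum_(k < d)
            (oppow (opabs (A k)) (2 * alpha) +
             oppow (opabs (opadj (A k))) (2 * (1 - alpha))))) <=
          1 / Num.sqrt 2 * (enorm A `^ 2^-1) *
          Num.sqrt (opnorm (\sum_(k < d)
            (oppow (opabs (A k)) (2 * alpha) +
             oppow (opabs (opadj (A k))) (2 * (1 - alpha)))))])
  /\
  (* (iii) *)
  [/\ eradius A <=
        1 / Num.sqrt 2 * \big[Num.max/0]_(k < d) (opnorm (A k) `^ 2^-1) *
        eradius (fun k =>
          oppow (opabs (A k)) 2^-1 +
          'i%C *: oppow (opabs (opadj (A k))) 2^-1),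
      1 / Num.sqrt 2 * \big[Num.max/0]_(k < d) (opnorm (A k) `^ 2^-1) *
        eradius (fun k =>
          oppow (opabs (A k)) 2^-1 +
          'i%C *: oppow (opabs (opadj (A k))) 2^-1) <=
        1 / Num.sqrt 2 * \big[Num.max/0]_(k < d) (opnorm (A k) `^ 2^-1) *
        Num.sqrt (opnorm (\sum_(k < d) (opabs (A k) + opabs (opadj (A k)))))
    & 1 / Num.sqrt 2 * \big[Num.max/0]_(k < d) (opnorm (A k) `^ 2^-1) *
        Num.sqrt (opnorm (\sum_(k < d) (opabs (A k) + opabs (opadj (A k))))) <=
        1 / Num.sqrt 2 * (enorm A `^ 2^-1) *
        Num.sqrt (opnorm (\sum_(k < d) (opabs (A k) + opabs (opadj (A k)))))].
Proof.
have half01 : 0 <= (2^-1 : R) <= 1 by apply/andP; split; lra.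
have part1 alpha t : 0 <= alpha <= 1 -> 0 <= t <= 1 -> _ :=
  fun a01 t01 => And3 (eradius_le_max_eradius A a01 t01) (max_eradius_le_opnorm A a01 t01)
    (max_opnorm_le_enorm A alpha t01).
split; first by move=> alpha t; apply: part1.
have part2 alpha : 0 <= alpha <= 1 -> _ := fun a01 => part1 alpha 2^-1 a01 half01.
have e1 (a : R) : 2 * a * (1 - 2^-1) = a by field.
have e2 (a : R) : 4 * a * (1 - 2^-1) = 2 * a by field.
split; first by move=> alpha /part2; rewrite !e1 !e2.
have := part2 _ half01; rewrite !e1 !e2.
have -> : 1 - 2^-1 = 2^-1 :> R by field.
have -> : 2 * 2^-1 = 1 :> R by field.
have -> : \sum_(k < d) (oppow (opabs (A k)) 1 + oppow (opabs (opadj (A k))) 1) =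
    \sum_(k < d) (opabs (A k) + opabs (opadj (A k))).
  by apply: eq_bigr => k _; rewrite !oppow1//; apply: opabs_positive.
by [].
Qed.
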